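(* Let $f(z)=z+a_2z^2+a_3z^3+\cdots\in\mathcal{C}_{\arcsin}$. Then $$|a_2|\le \frac{1}{\pi},\qquad |a_3|\le \frac{1}{3\pi},\qquad |a_4|\le \frac{1}{6\pi}.$$ All three inequalities are sharp, i.e. for each of them there is a function in $\mathcal{C}_{\arcsin}$ for which equality holds.
   Context: Let $\Omega=\{z\in\mathbb{C}:|z|<1\}$. Let $\mathcal{A}$ be the family of analytic functions $f$ in $\Omega$ normalized by $f(z)=z+\sum_{n=2}^{\infty}a_nz^n$, and let $\mathcal{S}\subset\mathcal{A}$ be the subclass of univalent functions. A Schwarz function is an analytic $\omega:\Omega\to\mathbb{C}$ with $\omega(0)=0$ and $|\omega(z)|\le 1$ on $\Omega$. For analytic $g,h$ in $\Omega$, $g\prec h$ (subordination) means that there is a Schwarz function $\omega$ with $g(z)=h(\omega(z))$ for all $z\in\Omega$. With $\arcsin$ the principal branch ($\arcsin 0=0$), define $$\mathcal{C}_{\arcsin}=\left\{f\in\mathcal{S}:\ 1+\frac{zf''(z)}{f'(z)}\prec 1+\frac{2}{\pi}\arcsin z \text{ in } \Omega\right\}.$$ *)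

(* Defs.v *)
From Stdlib Require Import Reals Lra.
From Coquelicot Require Import Coquelicot.
Open Scope R_scope.

Definition unit_disk (z : C) : Prop := Cmod z < 1.

Definition analytic_on (U : C -> Prop) (f : C -> C) : Prop :=
  forall z : C, U z -> @ex_derive C_AbsRing C_NormedModule f z.

Definition univalent_on (U : C -> Prop) (f : C -> C) : Prop :=
  forall z w : C, U z -> U w -> f z = f w -> z = w.

(* f(z) = z + a_2 z^2 + a_3 z^3 + ... throughout the unit disk. *)
Definition normalized_expansion (f : C -> C) (a : nat -> C) : Prop :=
  a 0%nat = RtoC 0 /\ a 1%nat = RtoC 1 /\
  forall z : C, unit_disk z ->
    @is_pseries C_AbsRing C_NormedModule a z (f z).

Definition class_A (f : C -> C) : Prop :=
  analytic_on unit_disk f /\ exists a : nat -> C, normalized_expansion f a.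

Definition class_S (f : C -> C) : Prop :=
  class_A f /\ univalent_on unit_disk f.

Definition schwarz_function (w : C -> C) : Prop :=
  analytic_on unit_disk w /\ w (RtoC 0) = RtoC 0 /\
  forall z : C, unit_disk z -> Cmod (w z) <= 1.

Definition subordinate (g h : C -> C) : Prop :=
  exists w : C -> C, schwarz_function w /\
    forall z : C, unit_disk z -> g z = h (w z).

(* The argument in (-PI, PI]; the value at 0 is irrelevant. *)
Definition Carg (z : C) : R :=
  if Rle_dec 0 (Im z) then acos (Re z / Cmod z) else - acos (Re z / Cmod z).

Definition Clog (z : C) : C := (ln (Cmod z), Carg z).

Definition Csqrt (z : C) : C :=
  (sqrt (Cmod z) * cos (Carg z / 2), sqrt (Cmod z) * sin (Carg z / 2)).

(* arcsin z = -i Log (i z + sqrt (1 - z^2)) with principal Log and sqrt;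
   by Carcsin_spec and Re_Carcsin below, on the disk this is the inverse branch
   of sin with values in the strip |Re w| < PI / 2. *)
Definition Carcsin (z : C) : C :=
  (- Ci * Clog (Ci * z + Csqrt (1 - z * z)))%C.

(* The total division is harmless: f' has no zero in the disk, f being univalent. *)
Definition class_C_arcsin (f : C -> C) : Prop :=
  class_S f /\
  subordinate (fun z => 1 + z * C_derive (C_derive f) z / C_derive f z)%C
              (fun z => 1 + RtoC (2 / PI) * Carcsin z)%C.

Definition Cexp (z : C) : C := (exp (Re z) * cos (Im z), exp (Re z) * sin (Im z)).

Definition Csin (z : C) : C :=
  ((Cexp (Ci * z) - Cexp (- (Ci * z))) / (2 * Ci))%C.

Lemma Cmod_sqr (z : C) : Cmod z * Cmod z = Re z * Re z + Im z * Im z.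
Proof. generalize (Cmod2_alt z); simpl; lra. Qed.

Lemma polar (z : C) : z <> RtoC 0 ->
  z = (Cmod z * cos (Carg z), Cmod z * sin (Carg z)).
Proof.
intros Hz.
assert (Hm : 0 < Cmod z) by now apply Cmod_gt_0.
assert (Hq : -1 <= Re z / Cmod z <= 1).
{ assert (H := re_le_Cmod z); apply Rabs_le_between in H.
  split; [apply Rle_div_r | apply Rle_div_l]; lra. }
assert (Hs : Cmod z * sqrt (1 - (Re z / Cmod z)²) = Rabs (Im z)).
{ rewrite <- (Rabs_pos_eq (Cmod z)) at 1 by lra.
  rewrite <- sqrt_Rsqr_abs, <- sqrt_mult_alt by apply Rle_0_sqr.
  rewrite <- sqrt_Rsqr_abs; f_equal; unfold Rsqr.
  replace (Im z * Im z) with (Cmod z * Cmod z - Re z * Re z)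
    by (rewrite Cmod_sqr; ring).
  field; lra. }
rewrite (surjective_pairing z) at 1; fold (Re z); fold (Im z).
unfold Carg; destruct (Rle_dec 0 (Im z)) as [Hi | Hi]; f_equal.
- rewrite cos_acos by lra; field; lra.
- rewrite sin_acos by lra; rewrite Hs, Rabs_pos_eq; lra.
- rewrite cos_neg, cos_acos by lra; field; lra.
- rewrite sin_neg, sin_acos by lra.
  rewrite Ropp_mult_distr_r_reverse, Hs, Rabs_left; lra.
Qed.

Lemma Cexp_Clog (z : C) : z <> RtoC 0 -> Cexp (Clog z) = z.
Proof.
intros Hz; rewrite (polar z Hz) at 2; unfold Cexp, Clog; simpl.
now rewrite exp_ln by now apply Cmod_gt_0.
Qed.

Lemma Csqrt_sqr (z : C) : (Csqrt z * Csqrt z)%C = z.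
Proof.
destruct (Ceq_dec z (RtoC 0)) as [-> | Hz].
- unfold Csqrt; rewrite Cmod_0, sqrt_0; unfold Cmult; simpl.
  unfold RtoC; f_equal; ring.
- rewrite (polar z Hz) at 3; unfold Csqrt, Cmult; simpl.
  assert (Hm := sqrt_sqrt (Cmod z) (Cmod_ge_0 z)).
  assert (Ha : Carg z = 2 * (Carg z / 2)) by field.
  set (b := Carg z / 2) in *; rewrite Ha, cos_2a, sin_2a.
  set (s := sqrt _) in *; rewrite <- Hm; f_equal; ring.
Qed.

Lemma Cexp_opp_mult (z : C) : (Cexp z * Cexp (- z))%C = RtoC 1.
Proof.
destruct z as [x y]; unfold Cexp, Cmult, RtoC; simpl.
rewrite cos_neg, sin_neg, exp_Ropp.
assert (He := exp_pos x); assert (H := sin2_cos2 y); unfold Rsqr in H.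
f_equal; [rewrite <- H |]; field; lra.
Qed.

Lemma arcsin_log_arg_neq_0 (z : C) : (Ci * z + Csqrt (1 - z * z))%C <> RtoC 0.
Proof.
intros H0; assert (H := Csqrt_sqr (1 - z * z)); set (s := Csqrt _) in *.
apply C1_nz.
replace (RtoC 1) with (s * s + z * z)%C by (rewrite H; ring).
assert (Hi : (Ci * Ci = - (1))%C)
  by (unfold Ci, Cmult, Copp, RtoC; simpl; f_equal; ring).
replace (s * s + z * z)%C with ((Ci * z + s) * (s - Ci * z) + z * z * (Ci * Ci + 1))%C
  by ring.
rewrite H0, Hi; ring.
Qed.

Lemma Carcsin_spec (z : C) : Csin (Carcsin z) = z.
Proof.
assert (Hi : (Ci * Ci = - (1))%C)
  by (unfold Ci, Cmult, Copp, RtoC; simpl; f_equal; ring).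
assert (Hz := arcsin_log_arg_neq_0 z); assert (H := Csqrt_sqr (1 - z * z)).
unfold Csin, Carcsin; set (s := Csqrt _) in *; set (u := (Ci * z + s)%C) in *.
replace (Ci * (- Ci * Clog u))%C with (Clog u)
  by (transitivity (- (Ci * Ci) * Clog u)%C; [rewrite Hi |]; ring).
assert (Hv := Cexp_opp_mult (Clog u)); rewrite Cexp_Clog in Hv |- * by exact Hz.
replace (Cexp (- Clog u)) with (s - Ci * z)%C.
- unfold u; field; apply Ci_nz.
- transitivity ((s - Ci * z) * (u * Cexp (- Clog u)))%C; [rewrite Hv; ring |].
  transitivity ((s * s - (Ci * Ci) * (z * z)) * Cexp (- Clog u))%C;
    [unfold u; ring | rewrite H, Hi; ring].
Qed.

Lemma Carg_bound (z : C) : Rabs (Carg z) <= PI.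
Proof.
unfold Carg; generalize (acos_bound (Re z / Cmod z)); intros H.
destruct (Rle_dec 0 (Im z)); [| rewrite Rabs_Ropp]; rewrite Rabs_pos_eq; lra.
Qed.

Lemma Carg_Re_pos (z : C) : 0 < Re z -> Rabs (Carg z) < PI / 2.
Proof.
intros Hr.
assert (Hz : z <> RtoC 0) by (intros E; rewrite E in Hr; simpl in Hr; lra).
assert (Hm : 0 < Cmod z) by now apply Cmod_gt_0.
assert (Hp : Re z = Cmod z * cos (Carg z)) by now rewrite (polar z Hz) at 1.
assert (Hb := Carg_bound z).
destruct (Rlt_le_dec (Rabs (Carg z)) (PI / 2)) as [H | H]; [exact H |].
assert (Hc : cos (Rabs (Carg z)) <= 0) by (apply cos_le_0; lra).
assert (Ha : cos (Rabs (Carg z)) = cos (Carg z))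
  by (unfold Rabs; destruct Rcase_abs; [apply cos_neg | reflexivity]).
rewrite Ha in Hc; nra.
Qed.

Lemma Re_Carcsin (z : C) : unit_disk z -> Rabs (Re (Carcsin z)) < PI / 2.
Proof.
intros Hz.
assert (Hu : 0 < Re (Ci * z + Csqrt (1 - z * z))).
{ assert (H := f_equal Re (Csqrt_sqr (1 - z * z))).
  assert (Hs : 0 <= Re (Csqrt (1 - z * z))).
  { unfold Csqrt; simpl; apply Rmult_le_pos; [apply sqrt_pos |].
    assert (Hb := Carg_bound (1 - z * z)); apply Rabs_le_between in Hb.
    apply cos_ge_0; lra. }
  assert (Hm := Cmod_sqr z); assert (H0 := Cmod_ge_0 z); unfold unit_disk in Hz.
  set (s := Csqrt _) in *.
  destruct z as [x y]; destruct s as [p q].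
  unfold Re, Im, Cmult, Cplus, Cminus, Copp, Ci, RtoC in *; simpl in *; nra. }
replace (Re (Carcsin z)) with (Carg (Ci * z + Csqrt (1 - z * z)));
  [now apply Carg_Re_pos |].
unfold Carcsin, Clog, Ci, Cmult at 4, Copp; simpl; ring.
Qed.

(* Main.v *)
Require Import Defs.
From Stdlib Require Import Reals Lra Lia Arith Ranalysis5.
From Coquelicot Require Import Coquelicot.
Open Scope R_scope.

(** Bounds: write [w(z) = c1 z + c2 z^2 + c3 z^3 + ...] for the Schwarz function.
    Comparing coefficients gives [a2 = c1 / PI], [a3 = (c2 + k c1^2) / (3 PI)] and
    [a4 = (c3 + mu c1 c2 + nu c1^3) / (6 PI)] with [k = 2/PI], [mu = 3/PI],
    [nu = 1/6 + 2/PI^2]. Integrating [w P^2 / z^3] over circles, with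
    [P = 1 + a z + b z^2] and [|w| <= 1], gives
    [|c3 + 2 a c2 + c1 (2 b + a^2)| <= 1 + |a|^2 + |b|^2] for all [a, b] (F. Riesz,
    Landau); suitable [a, b] bound the three functionals by 1. The mean value
    property needs [w'] continuous, which follows from [w = sin (PI/2 z f''/f')]
    once [f'] is known to have no zero.

    Sharpness: for [n = 1, 2, 3] let [z f''/f' = k arcsin (z^n)]. Then
    [f' = exp (k/n L(z^n))] where [L(z)] is the integral of [arcsin t / t] from 0 to
    [z], and [|L| <= 2], so [|arg f'| <= 4/PI < PI/2]; hence [Re f' > 0] and [f] is
    univalent. *)

(** * Complex differentiability *)

(** The Schwarz function comes only as pointwise differentiable, without a power series. The
    identity [w = sin V], [V = PI/2 z f''/f'], supplies both its continuous derivative and its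
    Taylor coefficients; this is why [f'] must first be free of zeros. At a zero of [f'] the total
    division leaves no information about [f''], so zeros are excluded by a growth estimate along
    rays. The square in [w P^2] is Landau's device: the mean of [|P|^2] over a circle is known
    exactly by orthogonality. One of the parameters [a], [b] is taken to be the conjugate of a
    rotated [c1]: it costs [|c1|^2] on the right and contributes [2 |c1|^2] on the left, and the
    surplus absorbs the leftover term in [c1] alone. For sharpness, [z^n] makes the first nontrivial
    coefficient [a_(n+1) = k / (n (n+1))], which is [1/PI], [1/(3 PI)], [1/(6 PI)] for
    [n = 1, 2, 3]. All auxiliary series have real coefficients in [[0, 1]], up to termwise
    differentiation, so they converge on the disk. *)

Definition cder (F : C -> C) (z l : C) : Prop :=
  @is_derive C_AbsRing (AbsRing_NormedModule C_AbsRing) F z l.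
(** Two normed-module structures on [C] occur: the definitions of the theorem use [C_NormedModule],
    while the product and chain rules live over the absolute ring. They share the same limits, so
    the components of the proof are merely repackaged. *)
Lemma cder_iff F (z l : C) : @is_derive C_AbsRing C_NormedModule F z l <-> cder F z l.
Proof.
split; intros [[H1 H2 H3] H4]; (split; [split; [exact H1|exact H2|exact H3]|exact H4]).
Qed.

Lemma cder_eps F z l : cder F z l <-> (forall eps, 0 < eps -> exists d, 0 < d /\ forall w, Cmod (w - z) < d ->
   Cmod (F w - F z - l * (w - z)) <= eps * Cmod (w-z)).
Proof.
split.
- intros [_ H] eps He.
  destruct (H z (fun P H => H) (mkposreal eps He)) as [d Hd].
  exists d; split; [apply cond_pos|].
  intros w Hw. specialize (Hd w Hw). rewrite (Cmult_comm l).
  exact Hd.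
- intros H; split.
  + apply (is_linear_scal_l (K:=C_AbsRing) (V:=AbsRing_NormedModule C_AbsRing)).
  + intros x Hx eps.
    assert (E : z = x) by apply (is_filter_lim_locally_unique (K:=C_AbsRing) (V:=AbsRing_NormedModule C_AbsRing) z x Hx).
    subst x.
    destruct (H eps (cond_pos eps)) as (d & Hd & Hw).
    exists (mkposreal d Hd). intros w Hww. specialize (Hw w Hww).
    rewrite (Cmult_comm l) in Hw. exact Hw.
Qed.

Lemma cder_mult F G z f g : cder F z f -> cder G z g -> cder (fun w => F w * G w)%C z (f * G z + F z * g)%C.
Proof.
intros H1 H2. exact (is_derive_mult (K:=C_AbsRing) F G z f g H1 H2 Cmult_comm).
Qed.

Lemma cder_comp F G z f g : cder F (G z) f -> cder G z g -> cder (fun w => F (G w))%C z (f * g)%C.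
Proof.
intros H1 H2. rewrite Cmult_comm. exact (is_derive_comp (K:=C_AbsRing) (V:=AbsRing_NormedModule C_AbsRing) F G z f g H1 H2).
Qed.

Lemma cder_plus F G z f g : cder F z f -> cder G z g -> cder (fun w => F w + G w)%C z (f + g)%C.
Proof. intros H1 H2. exact (is_derive_plus (K:=C_AbsRing) (V:=AbsRing_NormedModule C_AbsRing) F G z f g H1 H2). Qed.

Lemma cder_const c z : cder (fun _ => c) z (RtoC 0).
Proof. exact (is_derive_const (K:=C_AbsRing) (V:=AbsRing_NormedModule C_AbsRing) c z). Qed.

Lemma cder_id z : cder (fun w => w) z (RtoC 1).
Proof. exact (is_derive_id (K:=C_AbsRing) z). Qed.

Lemma cder_eq F z l l' : cder F z l -> l = l' -> cder F z l'.
Proof. now intros H <-. Qed.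

Lemma cder_ext F G z l r : 0 < r -> (forall w, Cmod (w - z) < r -> F w = G w) -> cder F z l -> cder G z l.
Proof.
intros Hr H. apply is_derive_ext_loc. exists (mkposreal r Hr). intros w Hw. now apply H.
Qed.

Lemma cder_scal c F z f : cder F z f -> cder (fun w => c * F w)%C z (c * f)%C.
Proof.
intros H. eapply cder_eq; [apply cder_mult; [apply cder_const|exact H]|]. cbn beta. ring.
Qed.

Lemma cder_opp F z f : cder F z f -> cder (fun w => - F w)%C z (- f)%C.
Proof. intros H. exact (is_derive_opp (K:=C_AbsRing) (V:=AbsRing_NormedModule C_AbsRing) F z f H). Qed.

Lemma cder_minus F G z f g : cder F z f -> cder G z g -> cder (fun w => F w - G w)%C z (f - g)%C.
Proof. intros H1 H2. apply cder_plus; [|apply cder_opp]; assumption. Qed.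

Lemma Cmod_triangle_inv z w : Cmod z - Cmod w <= Cmod (z - w).
Proof.
assert (H := Cmod_triangle (z - w) w). replace (z - w + w)%C with z in H by ring. lra.
Qed.

Lemma Cmod_minus_sym z w : Cmod (z - w) = Cmod (w - z).
Proof. rewrite <- Cmod_opp. f_equal. ring. Qed.

Lemma cder_quadratic F z l K d : 0 < d ->
  (forall w, Cmod (w - z) < d -> Cmod (F w - F z - l * (w - z)) <= K * Cmod (w - z) ^ 2) -> cder F z l.
Proof.
intros Hd H. apply cder_eps. intros eps He.
assert (HK : 0 < Rabs K + 1) by (generalize (Rabs_pos K); lra).
exists (Rmin d (eps / (Rabs K + 1))). split.
- apply Rmin_pos; [assumption|]. now apply Rdiv_lt_0_compat.
- intros w Hw. assert (H1 := Rlt_le_trans _ _ _ Hw (Rmin_l _ _)). assert (H2 := Rlt_le_trans _ _ _ Hw (Rmin_r _ _)).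
  eapply Rle_trans; [now apply H|].
  apply Rlt_div_r in H2; [|assumption].
  assert (H3 := Cmod_ge_0 (w - z)). assert (H4 := Rle_abs K).
  set (m := Cmod (w - z)) in *. simpl. rewrite Rmult_1_r.
  assert (H5 : 0 <= m * (Rabs K - K)) by (apply Rmult_le_pos; lra). rewrite <- Rmult_assoc. apply Rmult_le_compat_r; lra.
Qed.

Lemma cder_inv z : z <> RtoC 0 -> cder Cinv z (- / (z * z))%C.
Proof.
intros Hz. assert (Hm : 0 < Cmod z) by now apply Cmod_gt_0.
apply cder_quadratic with (K := 2 / (Cmod z ^ 3)) (d := Cmod z / 2); [lra|].
intros w Hw. assert (H1 : Cmod z / 2 <= Cmod w).
{ assert (H := Cmod_triangle_inv z w). rewrite Cmod_minus_sym in H. lra. }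
assert (Hw0 : w <> RtoC 0). { intros ->. rewrite Cmod_0 in H1. lra. }
replace (/ w - / z - - / (z * z) * (w - z))%C with ((w - z) * (w - z) * / (w * (z * z)))%C by (field; auto).
rewrite !Cmod_mult, Cmod_inv, !Cmod_mult by (repeat apply Cmult_neq_0; assumption).
assert (H2 : / (Cmod w * (Cmod z * Cmod z)) <= 2 / Cmod z ^ 3).
{ replace (2 / Cmod z ^ 3) with (/ (Cmod z / 2 * (Cmod z * Cmod z))) by (field; lra).
  apply Rinv_le_contravar; [repeat apply Rmult_lt_0_compat; lra|apply Rmult_le_compat_r; [nra|lra]]. }
assert (H3 := Cmod_ge_0 (w - z)). rewrite (Rmult_comm (_ * _) (/ _)). replace (Cmod (w - z) ^ 2) with (Cmod (w - z) * Cmod (w - z)) by ring.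
apply Rmult_le_compat_r; [nra|exact H2].
Qed.

Lemma cder_cont F z l : cder F z l -> forall eps, 0 < eps -> exists d, 0 < d /\
  forall w, Cmod (w - z) < d -> Cmod (F w - F z) < eps.
Proof.
intros H eps He. apply cder_eps with (eps := 1) in H; [|lra]. destruct H as (d & Hd & H).
assert (Hl := Cmod_ge_0 l).
exists (Rmin d (eps / (Cmod l + 2))). split.
- apply Rmin_pos; [assumption|]. apply Rdiv_lt_0_compat; lra.
- intros w Hw. assert (H1 := Rlt_le_trans _ _ _ Hw (Rmin_l _ _)). assert (H2 := Rlt_le_trans _ _ _ Hw (Rmin_r _ _)).
  apply Rlt_div_r in H2; [|lra]. specialize (H w H1).
  assert (H3 := Cmod_triangle_inv (F w - F z) (l * (w - z))). rewrite Cmod_mult in H3.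
  assert (H4 := Cmod_ge_0 (w - z)). nra.
Qed.

Lemma rder_eps (f : R -> R) t l : is_derive f t l <-> (forall eps, 0 < eps -> exists d, 0 < d /\ forall s, Rabs (s - t) < d ->
   Rabs (f s - f t - l * (s - t)) <= eps * Rabs (s - t)).
Proof.
split.
- intros [_ H] eps He.
  destruct (H t (fun P H => H) (mkposreal eps He)) as [d Hd].
  exists d; split; [apply cond_pos|].
  intros w Hw. specialize (Hd w Hw). rewrite (Rmult_comm l).
  exact Hd.
- intros H; split.
  + apply (is_linear_scal_l (K:=R_AbsRing) (V:=R_NormedModule)).
  + intros x Hx eps.
    assert (E : t = x) by apply (is_filter_lim_locally_unique (K:=R_AbsRing) (V:=R_NormedModule) t x Hx).
    subst x.
    destruct (H eps (cond_pos eps)) as (d & Hd & Hw).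
    exists (mkposreal d Hd). intros w Hww. specialize (Hw w Hww).
    rewrite (Rmult_comm l) in Hw. exact Hw.
Qed.

Lemma Cmod_le_Re_Im z : Cmod z <= Rabs (Re z) + Rabs (Im z).
Proof.
assert (H := Cmod_sqr z). assert (H1 := Rabs_pos (Re z)). assert (H2 := Rabs_pos (Im z)).
assert (H3 := Cmod_ge_0 z).
assert (H4 : Rabs (Re z) * Rabs (Re z) = Re z * Re z) by (rewrite <- Rabs_mult; apply Rabs_pos_eq; nra).
assert (H5 : Rabs (Im z) * Rabs (Im z) = Im z * Im z) by (rewrite <- Rabs_mult; apply Rabs_pos_eq; nra).
nra.
Qed.

Lemma Re_le_Cmod z : Re z <= Cmod z.
Proof. eapply Rle_trans; [apply Rle_abs|apply re_le_Cmod]. Qed.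

Lemma Im_le_Cmod z : Rabs (Im z) <= Cmod z.
Proof. assert (H := Rmax_Cmod z). eapply Rle_trans; [apply Rmax_r|exact H]. Qed.

(** Chain rule along a path. Through it the real tools (mean value and intermediate value theorems,
    integrals in the angle) apply to holomorphic functions. *)
Lemma cder_path F (g : R -> C) t l p q : cder F (g t) l ->
  is_derive (fun s => Re (g s)) t p -> is_derive (fun s => Im (g s)) t q ->
  is_derive (fun s => Re (F (g s))) t (Re (l * (p, q))).
Proof.
intros HF Hp Hq. rewrite rder_eps in *. rewrite cder_eps in HF.
intros eps He.
assert (Hl := Cmod_ge_0 l). assert (Hpq := Cmod_ge_0 (p, q)).
(* Half of [eps] pays for linearizing the path, an error multiplied by [l], and half for linearizing
   [F]. The cap [e1 <= 1] gives the Lipschitz bound [Cmod (p, q) + 2] for [g] near [t], on which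
   [e2] is based. *)
set (e1 := Rmin 1 (eps / 2 / (2 * (Cmod l + 1)))).
assert (He1 : 0 < e1) by (apply Rmin_pos; [lra|]; repeat apply Rdiv_lt_0_compat; lra).
assert (He1' : e1 <= 1) by apply Rmin_l.
assert (He1'' : e1 * (2 * (Cmod l + 1)) <= eps / 2) by (apply Rle_div_r; [lra|apply Rmin_r]).
set (e2 := eps / 2 / (Cmod (p,q) + 2)).
assert (He2 : 0 < e2) by (repeat apply Rdiv_lt_0_compat; lra).
destruct (Hp e1 He1) as (d1 & Hd1 & H1). destruct (Hq e1 He1) as (d2 & Hd2 & H2).
destruct (HF e2 He2) as (d3 & Hd3 & H3).
exists (Rmin (Rmin d1 d2) (d3 / (Cmod (p,q) + 2))). split.
{ repeat apply Rmin_pos; try assumption. apply Rdiv_lt_0_compat; lra. }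
intros s Hs.
assert (Hs1 : Rabs (s - t) < d1) by (eapply Rlt_le_trans; [exact Hs|]; eapply Rle_trans; [apply Rmin_l|apply Rmin_l]).
assert (Hs2 : Rabs (s - t) < d2) by (eapply Rlt_le_trans; [exact Hs|]; eapply Rle_trans; [apply Rmin_l|apply Rmin_r]).
assert (Hs3 : Rabs (s - t) * (Cmod (p,q) + 2) < d3) by (apply Rlt_div_r; [lra|]; eapply Rlt_le_trans; [exact Hs|apply Rmin_r]).
specialize (H1 s Hs1). specialize (H2 s Hs2).
set (x := Rabs (s - t)) in *. assert (Hx : 0 <= x) by apply Rabs_pos.
assert (HD : Cmod (g s - g t - (p, q) * RtoC (s - t)) <= 2 * e1 * x).
{ eapply Rle_trans; [apply Cmod_le_Re_Im|].
  replace (Re (g s - g t - (p, q) * RtoC (s - t))) with (Re (g s) - Re (g t) - p * (s - t))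
    by (unfold Re, Im, Cminus, Cplus, Copp, Cmult, RtoC; simpl; ring).
  replace (Im (g s - g t - (p, q) * RtoC (s - t))) with (Im (g s) - Im (g t) - q * (s - t))
    by (unfold Re, Im, Cminus, Cplus, Copp, Cmult, RtoC; simpl; ring).
  lra. }
assert (HG : Cmod (g s - g t) <= (Cmod (p,q) + 2) * x).
{ assert (H := Cmod_triangle_inv (g s - g t) ((p, q) * RtoC (s - t))).
  rewrite Cmod_mult, Cmod_R in H. fold x in H. nra. }
assert (H4 : Cmod (F (g s) - F (g t) - l * (g s - g t)) <= eps / 2 * x).
{ eapply Rle_trans; [apply H3; nra|].
  replace (eps / 2) with (e2 * (Cmod (p, q) + 2)) by (unfold e2; field; lra). nra. }
replace (Re (F (g s)) - Re (F (g t)) - Re (l * (p, q)) * (s - t))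
  with (Re (F (g s) - F (g t) - l * (g s - g t) + l * (g s - g t - (p, q) * RtoC (s - t)))).
2:{ unfold Re, Im, Cminus, Cplus, Copp, Cmult, RtoC; simpl; ring. }
eapply Rle_trans; [apply re_le_Cmod|]. eapply Rle_trans; [apply Cmod_triangle|].
rewrite Cmod_mult. nra.
Qed.

Lemma is_derive_eq (f : R -> R) t l l' : is_derive f t l -> l = l' -> is_derive f t l'.
Proof. now intros H <-. Qed.

(** The imaginary part is the real part of [- Ci * F]. *)
Lemma cder_path_Im F (g : R -> C) t l p q : cder F (g t) l ->
  is_derive (fun s => Re (g s)) t p -> is_derive (fun s => Im (g s)) t q ->
  is_derive (fun s => Im (F (g s))) t (Im (l * (p, q))).
Proof.
intros HF Hp Hq.
assert (H := cder_path (fun w => - Ci * F w)%C g t _ p q (cder_scal (- Ci) F _ _ HF) Hp Hq).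
eapply is_derive_eq.
- eapply is_derive_ext; [|exact H]. intros s. cbn beta. unfold Re, Im, Cmult, Copp, Ci; simpl; ring.
- unfold Re, Im, Cmult, Copp, Ci; simpl; ring.
Qed.

Lemma cder_segment F z h t l : cder F (z + RtoC t * h) l ->
  is_derive (fun s => Re (F (z + RtoC s * h)%C)) t (Re (l * h)) /\
  is_derive (fun s => Im (F (z + RtoC s * h)%C)) t (Im (l * h)).
Proof.
intros H.
assert (H1 : is_derive (fun s => Re (z + RtoC s * h)) t (Re h)).
{ apply is_derive_ext with (fun s => Re z + s * Re h).
  - intros s. unfold Re, Im, Cplus, Cmult, RtoC; simpl; ring.
  - auto_derive; [trivial|ring]. }
assert (H2 : is_derive (fun s => Im (z + RtoC s * h)) t (Im h)).
{ apply is_derive_ext with (fun s => Im z + s * Im h).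
  - intros s. unfold Re, Im, Cplus, Cmult, RtoC; simpl; ring.
  - auto_derive; [trivial|ring]. }
assert (K1 := cder_path F (fun s => z + RtoC s * h)%C _ _ _ _ H H1 H2).
assert (K2 := cder_path_Im F (fun s => z + RtoC s * h)%C _ _ _ _ H H1 H2).
replace (Re h, Im h) with h in K1, K2 by now destruct h.
now split.
Qed.

Lemma is_derive_continuity_pt (f : R -> R) t l : is_derive f t l -> continuity_pt f t.
Proof.
intros H. apply continuity_pt_filterlim, (ex_derive_continuous (V:=R_NormedModule)). now exists l.
Qed.

Lemma const_of_derive_0 (f : R -> R) (df : R -> R) a b : a <= b ->
  (forall t, a <= t <= b -> is_derive f t (df t)) -> (forall t, a < t < b -> df t = 0) -> f a = f b.
Proof.
intros Hab H H0.
destruct (MVT_gen f a b (fun _ => 0)) as (c & Hc & E); try (rewrite Rmin_left, Rmax_right by lra).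
- intros x Hx. rewrite <- (H0 x) by lra. apply H; lra.
- intros x Hx. apply is_derive_continuity_pt with (df x). now apply H.
- lra.
Qed.

Lemma disk_seg z t : unit_disk z -> 0 <= t <= 1 -> unit_disk (RtoC t * z).
Proof.
unfold unit_disk. intros Hz Ht. rewrite Cmod_mult, Cmod_R, Rabs_pos_eq by lra.
assert (H := Cmod_ge_0 z). nra.
Qed.

(** The origin is exempted because identities of the form [z * F1 z = 0] say nothing there. On the
    segment from 0 to [z] this only affects an endpoint, which the mean value theorem ignores. *)
Lemma disk_const F F1 : (forall z, unit_disk z -> cder F z (F1 z)) ->
  (forall z, unit_disk z -> z <> RtoC 0 -> F1 z = RtoC 0) -> forall z, unit_disk z -> F z = F (RtoC 0).
Proof.
intros H H0 z Hz.
destruct (Ceq_dec z (RtoC 0)) as [-> | Hn]; [reflexivity|].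
assert (Hd : forall t, 0 <= t <= 1 ->
  is_derive (fun s => Re (F (0 + RtoC s * z)%C)) t (Re (F1 (RtoC t * z)%C * z)) /\
  is_derive (fun s => Im (F (0 + RtoC s * z)%C)) t (Im (F1 (RtoC t * z)%C * z))).
{ intros t Ht. apply cder_segment. rewrite Cplus_0_l. now apply H, disk_seg. }
assert (Hz0 : forall t, 0 < t < 1 -> F1 (RtoC t * z)%C = RtoC 0).
{ intros t Ht. apply H0; [apply disk_seg; [assumption|lra]|]. apply Cmult_neq_0; [|assumption].
  intros E. apply RtoC_inj in E. lra. }
assert (HR := const_of_derive_0 _ _ 0 1 Rle_0_1 (fun t Ht => proj1 (Hd t Ht))).
assert (HI := const_of_derive_0 _ _ 0 1 Rle_0_1 (fun t Ht => proj2 (Hd t Ht))).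
cbv beta in HR, HI. rewrite Cplus_0_l in HR, HI. rewrite Cplus_0_l in HR, HI.
rewrite Cmult_0_l, Cmult_1_l in HR, HI.
symmetry. apply injective_projections; [apply HR|apply HI]; intros t Ht; rewrite Hz0, Cmult_0_l by assumption; reflexivity.
Qed.

(** * Complex power series *)

Definition cseries (c : nat -> C) (l : C) : Prop := @is_series C_AbsRing C_NormedModule c l.

Lemma sum_n_Re_Im (c : nat -> C) n :
  sum_n (G := C_NormedModule) c n = (sum_n (fun k => Re (c k)) n, sum_n (fun k => Im (c k)) n).
Proof.
induction n as [|n IH].
- rewrite !sum_O. now destruct (c 0%nat).
- rewrite !sum_Sn, IH. reflexivity.
Qed.

Lemma cseries_iff (c : nat -> C) (l : C) : cseries c l <-> is_series (fun n => Re (c n)) (Re l) /\ is_series (fun n => Im (c n)) (Im l).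
Proof.
unfold cseries, is_series. split.
- intros H. split; apply filterlim_locally; intros eps;
    generalize (proj1 (filterlim_locally _ _) H eps); apply filter_imp;
    intros n Hn; rewrite sum_n_Re_Im in Hn; apply Hn.
- intros [H1 H2]. apply filterlim_locally. intros eps.
  generalize (filter_and _ _ (proj1 (filterlim_locally _ _) H1 eps) (proj1 (filterlim_locally _ _) H2 eps)).
  apply filter_imp. intros n [K1 K2]. rewrite sum_n_Re_Im. split; assumption.
Qed.

Definition CSeries (c : nat -> C) : C := (Series (fun n => Re (c n)), Series (fun n => Im (c n))).

Lemma cseries_unique (c : nat -> C) (l : C) : cseries c l -> CSeries c = l.
Proof.
intros H. apply cseries_iff in H. destruct H as [H1 H2]. unfold CSeries.
rewrite (is_series_unique _ _ H1), (is_series_unique _ _ H2). now destruct l.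
Qed.

Lemma cseries_ext (c c' : nat -> C) (l : C) : (forall n, c n = c' n) -> cseries c l -> cseries c' l.
Proof. apply is_series_ext. Qed.

Lemma cseries_abs (c : nat -> C) (r : nat -> R) : (forall n, Cmod (c n) <= r n) -> ex_series r -> cseries c (CSeries c).
Proof.
intros H Hr. apply cseries_iff. split; apply Series_correct; apply (ex_series_le (V := R_CompleteNormedModule)) with r; try assumption;
intros n; (eapply Rle_trans; [|apply H]).
- apply re_le_Cmod.
- apply Im_le_Cmod.
Qed.

Lemma cseries_bound (c : nat -> C) (l : C) (r : nat -> R) : cseries c l -> (forall n, Cmod (c n) <= r n) -> ex_series r -> Cmod l <= Series r.
Proof.
intros H Hc Hr.
change (Rbar_le (Cmod l) (Series r)).
apply (filterlim_le (F := eventually) (fun n => Cmod (sum_n (G:=C_NormedModule) c n)) (sum_n r)).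
- apply filter_forall. intros n.
  eapply Rle_trans; [apply (norm_sum_n_m (K:=C_AbsRing) (V:=C_NormedModule))|]. apply sum_n_m_le. exact Hc.
- eapply filterlim_comp; [exact H|]. apply (filterlim_norm (K:=C_AbsRing) (V:=C_NormedModule)).
- exact (Series_correct _ Hr).
Qed.

Lemma cseries_plus (c d : nat -> C) (k l : C) : cseries c k -> cseries d l -> cseries (fun n => c n + d n)%C (k + l)%C.
Proof. apply (is_series_plus (K:=C_AbsRing) (V:=C_NormedModule)). Qed.

Lemma cseries_scal (a : C) (c : nat -> C) (k : C) : cseries c k -> cseries (fun n => a * c n)%C (a * k)%C.
Proof. apply (is_series_scal_l (K:=C_AbsRing) (V:=C_NormedModule)). Qed.

Lemma cseries_shift (c : nat -> C) (l : C) : cseries c l -> cseries (fun n => c (S n)) (l - c 0%nat)%C.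
Proof.
intros H. apply (is_series_incr_1 (K:=C_AbsRing) (V:=C_NormedModule)).
change (cseries c (l - c 0%nat + c 0%nat)%C). now replace (l - c 0%nat + c 0%nat)%C with l by ring.
Qed.

Lemma cseries_unshift (c : nat -> C) (l : C) : cseries (fun n => c (S n)) (l - c 0%nat)%C -> cseries c l.
Proof. apply (is_series_decr_1 (K:=C_AbsRing) (V:=C_NormedModule)). Qed.

Lemma pow_n_Cpow (z : C) n : pow_n (K:=C_AbsRing) z n = Cpow z n.
Proof. induction n as [|n IH]; [reflexivity|]. simpl. now rewrite IH. Qed.

Lemma is_pseries_cseries (a : nat -> C) (z l : C) :
  @is_pseries C_AbsRing C_NormedModule a z l <-> cseries (fun n => a n * z ^ n)%C l.
Proof.
assert (E : forall n, @scal C_AbsRing C_NormedModule (pow_n z n) (a n) = (a n * z ^ n)%C).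
{ intros n. transitivity (z ^ n * a n)%C; [|apply Cmult_comm]. exact (f_equal (fun w => Cmult w (a n)) (pow_n_Cpow z n)). }
split; apply is_series_ext; intros n; now rewrite E.
Qed.

(** Says that the radius of convergence is at least 1, in a form that passes easily to termwise
    derivatives. *)
Definition tame (a : nat -> C) : Prop :=
  forall r, 0 <= r < 1 -> exists M, forall n, Cmod (a n) * r ^ n <= M.

Lemma cseries_tame (a : nat -> C) : (forall z, unit_disk z -> exists l, cseries (fun n => a n * z ^ n)%C l) -> tame a.
Proof.
intros H r Hr. destruct (H (RtoC r)) as [l Hl].
{ unfold unit_disk. rewrite Cmod_R, Rabs_pos_eq; lra. }
assert (HS : forall n, Cmod (a n) * r ^ n = Cmod (a n * RtoC r ^ n)).
{ intros n. rewrite Cmod_mult, Cmod_pow, Cmod_R, Rabs_pos_eq by lra. reflexivity. }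
apply cseries_iff in Hl. destruct Hl as [H1 H2].
assert (L1 := ex_series_lim_0 _ (ex_intro _ _ H1)). assert (L2 := ex_series_lim_0 _ (ex_intro _ _ H2)).
destruct (filterlim_bounded (V:=R_NormedModule) _ (ex_intro _ 0 L1)) as [M1 K1].
destruct (filterlim_bounded (V:=R_NormedModule) _ (ex_intro _ 0 L2)) as [M2 K2].
exists (M1 + M2). intros n. rewrite HS. eapply Rle_trans; [apply Cmod_le_Re_Im|].
apply Rplus_le_compat; [apply K1|apply K2].
Qed.

(** Abel's lemma: boundedness at the larger radius [s] gives comparison with a geometric series of
    ratio [r / s]. *)
Lemma tame_ex_series a r : tame a -> 0 <= r < 1 -> ex_series (fun n => Cmod (a n) * r ^ n).
Proof.
intros Ha Hr. set (s := (1 + r) / 2). assert (Hs : 0 < s < 1 /\ r < s) by (unfold s; lra).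
destruct (Ha s) as [M HM]; [lra|].
apply (ex_series_le (V := R_CompleteNormedModule)) with (fun n => M * (r / s) ^ n).
- intros n. change (Rabs (Cmod (a n) * r ^ n) <= M * (r / s) ^ n).
  rewrite Rabs_pos_eq by (apply Rmult_le_pos; [apply Cmod_ge_0|apply pow_le; lra]).
  replace (r ^ n) with (s ^ n * (r / s) ^ n) by (rewrite <- Rpow_mult_distr; f_equal; field; lra).
  rewrite <- Rmult_assoc. apply Rmult_le_compat_r; [|apply HM].
  apply pow_le. apply Rdiv_le_0_compat; lra.
- apply (ex_series_scal_l (K:=R_AbsRing) (V:=R_NormedModule)). apply ex_series_geom.
  rewrite Rabs_pos_eq by (apply Rdiv_le_0_compat; lra). apply Rlt_div_l; lra.
Qed.

Definition CPS (a : nat -> C) (z : C) : C := CSeries (fun n => a n * z ^ n)%C.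

Lemma CPS_correct a z : tame a -> unit_disk z -> cseries (fun n => a n * z ^ n)%C (CPS a z).
Proof.
intros Ha Hz. apply cseries_abs with (fun n => Cmod (a n) * Cmod z ^ n).
- intros n. rewrite Cmod_mult, Cmod_pow. lra.
- apply tame_ex_series; [assumption|]. split; [apply Cmod_ge_0|exact Hz].
Qed.

Lemma CPS_unique (a : nat -> C) (z l : C) : cseries (fun n => a n * z ^ n)%C l -> CPS a z = l.
Proof. apply cseries_unique. Qed.

Lemma CPS_0 a : CPS a (RtoC 0) = a 0%nat.
Proof.
apply CPS_unique, cseries_unshift. simpl.
replace (a 0%nat - a 0%nat * 1)%C with (RtoC 0) by ring.
apply cseries_ext with (fun _ => RtoC 0).
{ intros n. simpl. ring. }
apply cseries_iff. simpl.
assert (is_series (fun _ : nat => 0) 0).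
{ apply is_series_ext with (fun n => 0 * (1/2) ^ n); [intros n; apply Rmult_0_l|].
  generalize (is_series_scal_l (K:=R_AbsRing) (V:=R_NormedModule) 0 _ _ (is_series_geom (1/2) ltac:(rewrite Rabs_pos_eq; lra))).
  unfold scal; simpl; unfold mult; simpl. now rewrite Rmult_0_l. }
now split.
Qed.

Definition derived (a : nat -> C) (n : nat) : C := (RtoC (INR (S n)) * a (S n))%C.

(** Each of the [n + 1] terms of [1 + q + ... + q^n] is at least [q^n], and the sum times [1 - q]
    telescopes. This lets a geometric factor absorb the factor [n + 1] of a differentiated
    series. *)
Lemma INR_pow_bound q n : 0 <= q < 1 -> INR (S n) * q ^ n * (1 - q) <= 1 - q ^ S n.
Proof.
intros Hq. induction n as [|n IH].
- simpl. lra.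
- rewrite S_INR. assert (0 <= q ^ S n <= 1).
  { split; [apply pow_le; lra|]. rewrite <- (pow1 (S n)). apply pow_incr. lra. }
  replace ((INR (S n) + 1) * q ^ S n * (1 - q)) with (q * (INR (S n) * q ^ n * (1 - q)) + q ^ S n * (1 - q)) by (simpl; ring).
  replace (q ^ S (S n)) with (q * q ^ S n) by reflexivity. nra.
Qed.

Lemma tame_derived a : tame a -> tame (derived a).
Proof.
intros Ha r Hr. set (s := (1 + r) / 2). assert (Hs : 0 < s < 1 /\ r < s) by (unfold s; lra).
destruct (Ha s) as [M HM]; [lra|].
assert (Hsp : 0 < / s) by (apply Rinv_0_lt_compat; lra).
exists (M / s * (1 / (1 - r / s))). intros n.
unfold derived. rewrite Cmod_mult, Cmod_R, (Rabs_pos_eq (INR _)) by apply pos_INR.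
assert (Hq : 0 <= r / s < 1) by (split; [apply Rdiv_le_0_compat; lra|apply Rlt_div_l; lra]).
replace (INR (S n) * Cmod (a (S n)) * r ^ n) with (Cmod (a (S n)) * s ^ S n / s * (INR (S n) * (r / s) ^ n)).
2:{ unfold Rdiv. rewrite Rpow_mult_distr, pow_inv. simpl. field. split; [apply pow_nonzero|]; lra. }
assert (Hp : 0 <= (r / s) ^ n) by (apply pow_le; lra).
assert (H1 : Cmod (a (S n)) * s ^ S n / s <= M / s) by (apply Rmult_le_compat_r; [lra|apply HM]).
set (q := r / s) in *. clearbody q.
assert (H2 : INR (S n) * q ^ n <= 1 / (1 - q)).
{ apply -> Rle_div_r; [|lra]. assert (H := INR_pow_bound q n Hq).
  assert (0 <= q ^ S n) by (apply pow_le; lra). lra. }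
apply Rmult_le_compat; try assumption.
- apply Rmult_le_pos; [|lra]. apply Rmult_le_pos; [apply Cmod_ge_0|apply pow_le; lra].
- apply Rmult_le_pos; [apply pos_INR|assumption].
Qed.

(** The remainder [R_n] of the linear approximation satisfies
    [R_(n+1) = w R_n + (n+1) z^n (w - z)^2]. Writing [rho ^ n / rho] avoids a truncated [n - 1]; at
    [n = 0] the factor [INR n] vanishes. The constant is twice what the recursion gives. *)
Lemma Cpow_diff_quadratic z w rho n : 0 < rho -> Cmod z <= rho -> Cmod w <= rho ->
  Cmod (w ^ S n - z ^ S n - RtoC (INR (S n)) * z ^ n * (w - z)) <= INR n * INR (S n) * rho ^ n / rho * Cmod (w - z) ^ 2.
Proof.
intros Hr Hz Hw. induction n as [|n IH].
- simpl. replace (w * 1 - z * 1 - 1 * 1 * (w - z))%C with (RtoC 0) by ring. rewrite Cmod_0. lra.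
- set (h := Cmod (w - z) ^ 2) in *. assert (Hh : 0 <= h) by apply pow2_ge_0.
  replace (w ^ S (S n) - z ^ S (S n) - RtoC (INR (S (S n))) * z ^ S n * (w - z))%C
    with (w * (w ^ S n - z ^ S n - RtoC (INR (S n)) * z ^ n * (w - z)) + RtoC (INR (S n)) * z ^ n * ((w - z) * (w - z)))%C.
  2:{ rewrite (S_INR (S n)), RtoC_plus. simpl Cpow. ring. }
  eapply Rle_trans; [apply Cmod_triangle|]. rewrite !Cmod_mult, Cmod_R, Cmod_pow, (Rabs_pos_eq (INR _)) by apply pos_INR.
  replace (Cmod (w - z) * Cmod (w - z)) with h by (unfold h; ring).
  assert (H1 : Cmod z ^ n <= rho ^ n) by (apply pow_incr; split; [apply Cmod_ge_0|assumption]).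
  assert (H2 : 0 <= rho ^ n) by (apply pow_le; lra).
  assert (H3 : Cmod w * Cmod (w ^ S n - z ^ S n - RtoC (INR (S n)) * z ^ n * (w - z)) <= rho * (INR n * INR (S n) * rho ^ n / rho * h)).
  { apply Rmult_le_compat; try apply Cmod_ge_0; assumption. }
  assert (H4 : INR (S n) * Cmod z ^ n * h <= INR (S n) * rho ^ n * h).
  { apply Rmult_le_compat_r; [assumption|]. apply Rmult_le_compat_l; [apply pos_INR|assumption]. }
  replace (INR (S n) * INR (S (S n)) * rho ^ S n / rho * h) with (rho * (INR n * INR (S n) * rho ^ n / rho * h) + 2 * (INR (S n) * rho ^ n * h)).
  2:{ rewrite !S_INR. simpl. field. lra. }
  assert (0 <= INR (S n) * rho ^ n * h) by (apply Rmult_le_pos; [apply Rmult_le_pos; [apply pos_INR|assumption]|assumption]). lra.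
Qed.

(** Summing the quadratic remainders of the powers gives a quadratic remainder for the series. Its
    constant is, up to factors of [rho] and a shift, the twice differentiated series of moduli at a
    radius [rho] between [Cmod z] and 1, hence finite. *)
Lemma cder_CPS a z : tame a -> unit_disk z -> cder (CPS a) z (CPS (derived a) z).
Proof.
intros Ha Hz. unfold unit_disk in Hz. set (rho := (1 + Cmod z) / 2).
assert (Hz0 := Cmod_ge_0 z). assert (Hr : 0 < rho < 1 /\ Cmod z < rho) by (unfold rho; lra).
assert (Hex : ex_series (fun n => Cmod (a (S n)) * (INR n * INR (S n) * rho ^ n / rho))).
{ apply ex_series_ext with (fun n => / rho * (INR n * Cmod (derived a n) * rho ^ n)).
  { intros n. unfold derived. rewrite Cmod_mult, Cmod_R, (Rabs_pos_eq (INR _)) by apply pos_INR. simpl. field. lra. }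
  apply (ex_series_scal_l (K:=R_AbsRing) (V:=R_NormedModule)).
  apply ex_series_incr_1.
  apply ex_series_ext with (fun n => rho * (Cmod (derived (derived a) n) * rho ^ n)).
  { intros n. unfold derived at 1. rewrite Cmod_mult, Cmod_R, (Rabs_pos_eq (INR _)) by apply pos_INR. simpl. ring. }
  apply (ex_series_scal_l (K:=R_AbsRing) (V:=R_NormedModule)). apply tame_ex_series; [|lra].
  now apply tame_derived, tame_derived. }
apply cder_quadratic with (K := Series (fun n => Cmod (a (S n)) * (INR n * INR (S n) * rho ^ n / rho))) (d := rho - Cmod z); [lra|].
intros w Hw. assert (Hwr : Cmod w < rho) by (generalize (Cmod_triangle_inv w z); lra).
rewrite Rmult_comm, <- Series_scal_l.
assert (S1 := cseries_shift _ _ (CPS_correct a w Ha ltac:(unfold unit_disk; lra))).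
assert (S2 := cseries_shift _ _ (CPS_correct a z Ha ltac:(unfold unit_disk; lra))).
assert (S3 := CPS_correct (derived a) z (tame_derived a Ha) ltac:(unfold unit_disk; lra)).
assert (S4 := cseries_plus _ _ _ _ (cseries_plus _ _ _ _ S1 (cseries_scal (-(1))%C _ _ S2)) (cseries_scal (- (w - z))%C _ _ S3)).
cbv beta in S4.
replace (CPS a w - CPS a z - CPS (derived a) z * (w - z))%C with
  ((CPS a w - a 0%nat * w ^ 0 + - (1) * (CPS a z - a 0%nat * z ^ 0)) + - (w - z) * CPS (derived a) z)%C by (simpl; ring).
eapply cseries_bound; [exact S4| |].
- intros n. cbv beta. unfold derived.
  replace (a (S n) * w ^ S n + - (1) * (a (S n) * z ^ S n) + - (w - z) * (RtoC (INR (S n)) * a (S n) * z ^ n))%C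
    with (a (S n) * (w ^ S n - z ^ S n - RtoC (INR (S n)) * z ^ n * (w - z)))%C by ring.
  rewrite Cmod_mult, (Rmult_comm (Cmod (w - z) ^ 2)), Rmult_assoc. apply Rmult_le_compat_l; [apply Cmod_ge_0|].
  apply Cpow_diff_quadratic; lra.
- apply (ex_series_scal_l (K:=R_AbsRing) (V:=R_NormedModule)). exact Hex.
Qed.

Lemma Re_sum_n (c : nat -> C) n : Re (sum_n (G:=C_NormedModule) c n) = sum_n (fun k => Re (c k)) n.
Proof. now rewrite sum_n_Re_Im. Qed.

Lemma Im_sum_n (c : nat -> C) n : Im (sum_n (G:=C_NormedModule) c n) = sum_n (fun k => Im (c k)) n.
Proof. now rewrite sum_n_Re_Im. Qed.

Lemma cseries_mult (c d : nat -> C) (k l : C) : cseries c k -> cseries d l ->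
  ex_series (fun n => Cmod (c n)) -> ex_series (fun n => Cmod (d n)) ->
  cseries (fun n => sum_n (G:=C_NormedModule) (fun i => c i * d (n - i)%nat)%C n) (k * l)%C.
Proof.
intros Hc Hd Ac Ad. apply cseries_iff in Hc. apply cseries_iff in Hd.
destruct Hc as [Hc1 Hc2]. destruct Hd as [Hd1 Hd2].
assert (AR : forall e, ex_series (fun n => Cmod (e n)) -> ex_series (fun n => Rabs (Re (e n)))).
{ intros e He. apply (ex_series_le (V := R_CompleteNormedModule)) with (fun n => Cmod (e n)); [|assumption].
  intros n. change (Rabs (Rabs (Re (e n))) <= Cmod (e n)). rewrite Rabs_Rabsolu. apply re_le_Cmod. }
assert (AI : forall e, ex_series (fun n => Cmod (e n)) -> ex_series (fun n => Rabs (Im (e n)))).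
{ intros e He. apply (ex_series_le (V := R_CompleteNormedModule)) with (fun n => Cmod (e n)); [|assumption].
  intros n. change (Rabs (Rabs (Im (e n))) <= Cmod (e n)). rewrite Rabs_Rabsolu. apply Im_le_Cmod. }
assert (RR := is_series_mult _ _ _ _ Hc1 Hd1 (AR _ Ac) (AR _ Ad)).
assert (RI := is_series_mult _ _ _ _ Hc1 Hd2 (AR _ Ac) (AI _ Ad)).
assert (IR := is_series_mult _ _ _ _ Hc2 Hd1 (AI _ Ac) (AR _ Ad)).
assert (II := is_series_mult _ _ _ _ Hc2 Hd2 (AI _ Ac) (AI _ Ad)).
apply cseries_iff. split.
- eapply is_series_ext; [|exact (is_series_minus _ _ _ _ RR II)].
  intros n. cbv beta. rewrite Re_sum_n, sum_n_Reals. unfold minus, plus, opp; simpl.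
  change (sum_f_R0 (fun k0 => Re (c k0) * Re (d (n - k0)%nat)) n - sum_f_R0 (fun k0 => Im (c k0) * Im (d (n - k0)%nat)) n = sum_f_R0 (fun k0 => Re (c k0 * d (n - k0)%nat)) n).
  rewrite <- minus_sum. reflexivity.
- eapply is_series_ext; [|exact (is_series_plus _ _ _ _ RI IR)].
  intros n. cbv beta. rewrite Im_sum_n, sum_n_Reals. unfold plus; simpl.
  rewrite <- plus_sum. reflexivity.
Qed.

(** * Holomorphic functions on the disk *)

Lemma Cexp_plus z w : Cexp (z + w) = (Cexp z * Cexp w)%C.
Proof.
destruct z as [x y]; destruct w as [u v]. unfold Cexp, Cmult; simpl.
rewrite exp_plus, cos_plus, sin_plus. f_equal; ring.
Qed.

Lemma Cexp_0 : Cexp (RtoC 0) = RtoC 1.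
Proof. unfold Cexp, RtoC; simpl. rewrite exp_0, cos_0, sin_0. f_equal; ring. Qed.

Lemma cder_Cexp_0 : cder Cexp (RtoC 0) (RtoC 1).
Proof.
(* The real part of the error turns out to be at most [3 eps m] and the imaginary part at most
   [4 eps m], hence the 7. The cap at 1 keeps [exp x] below 2. *)
apply cder_eps. intros eps0 He0. set (eps := Rmin 1 (eps0 / 7)).
assert (He : 0 < eps) by (apply Rmin_pos; lra). assert (He1 : eps <= 1) by apply Rmin_l.
assert (He2 : eps <= eps0 / 7) by apply Rmin_r.
destruct (proj1 (rder_eps exp 0 (exp 0)) (is_derive_exp 0) eps He) as (d1 & Hd1 & H1).
destruct (proj1 (rder_eps cos 0 (- sin 0)) (is_derive_cos 0) eps He) as (d2 & Hd2 & H2).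
destruct (proj1 (rder_eps sin 0 (cos 0)) (is_derive_sin 0) eps He) as (d3 & Hd3 & H3).
exists (Rmin (Rmin d1 d2) (Rmin d3 (eps / 2))). split.
{ repeat apply Rmin_pos; lra. }
intros w Hw. rewrite Cexp_0. replace (w - 0)%C with w in * by ring.
assert (Hd := Rmin_l (Rmin d1 d2) (Rmin d3 (eps / 2))). assert (Hd' := Rmin_r (Rmin d1 d2) (Rmin d3 (eps / 2))).
assert (Hd12 := Rmin_l d1 d2). assert (Hd12' := Rmin_r d1 d2).
assert (Hd3e := Rmin_l d3 (eps / 2)). assert (Hd3e' := Rmin_r d3 (eps / 2)).
assert (HR := re_le_Cmod w). assert (HI := Im_le_Cmod w).
destruct w as [x y]. simpl in HR, HI.
specialize (H1 x). specialize (H2 y). specialize (H3 y).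
rewrite exp_0 in H1. rewrite sin_0, cos_0 in H2. rewrite sin_0, cos_0 in H3. rewrite Rminus_0_r in H1, H2, H3.
specialize (H1 ltac:(lra)). specialize (H2 ltac:(lra)). specialize (H3 ltac:(lra)).
eapply Rle_trans; [apply Cmod_le_Re_Im|].
unfold Cexp. simpl.
set (m := Cmod (x, y)) in *. set (E := exp x) in *.
replace (E * cos y + - (1) + - (1 * x - 0 * y)) with (E * (cos y - 1) + (E - 1 - x)) by ring.
replace (E * sin y + -0 + - (1 * y + 0 * x)) with (E * (sin y - y) + y * (E - 1)) by ring.
assert (HE : 0 < E) by apply exp_pos.
assert (Hx := Rabs_pos x). assert (Hy := Rabs_pos y).
assert (HE1 : Rabs (E - 1) <= 2 * Rabs x).
{ replace (E - 1) with ((E - 1 - x) + x) by ring. eapply Rle_trans; [apply Rabs_triang|].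
  replace (E - 1 - 1 * x) with (E - 1 - x) in H1 by ring. nra. }
assert (HE2 : E <= 2). { assert (H := Rle_abs (E - 1)). lra. }
replace (E - 1 - 1 * x) with (E - 1 - x) in H1 by ring.
replace (cos y - 1 - - 0 * y) with (cos y - 1) in H2 by ring.
replace (sin y - 0 - 1 * y) with (sin y - y) in H3 by ring.
assert (K1 : Rabs (E * (cos y - 1) + (E - 1 - x)) <= 3 * eps * m).
{ eapply Rle_trans; [apply Rabs_triang|]. rewrite Rabs_mult, (Rabs_pos_eq E) by lra.
  assert (E * Rabs (cos y - 1) <= 2 * (eps * Rabs y)) by (apply Rmult_le_compat; try lra; apply Rabs_pos).
  nra. }
assert (K2 : Rabs (E * (sin y - y) + y * (E - 1)) <= 4 * eps * m).
{ eapply Rle_trans; [apply Rabs_triang|]. rewrite !Rabs_mult, (Rabs_pos_eq E) by lra.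
  assert (E * Rabs (sin y - y) <= 2 * (eps * Rabs y)) by (apply Rmult_le_compat; try lra; apply Rabs_pos).
  assert (Rabs y * Rabs (E - 1) <= m * eps) by (apply Rmult_le_compat; try lra; apply Rabs_pos).
  nra. }
assert (0 <= m) by apply Cmod_ge_0. nra.
Qed.

Lemma cder_Cexp z : cder Cexp z (Cexp z).
Proof.
apply cder_ext with (F := fun w => (Cexp z * Cexp (w - z))%C) (r := 1); [lra| |].
- intros w _. rewrite <- Cexp_plus. f_equal. ring.
- eapply cder_eq; [apply cder_scal, (cder_comp Cexp)|].
  + replace (z - z)%C with (RtoC 0) by ring. apply cder_Cexp_0.
  + apply cder_minus; [apply cder_id|apply cder_const].
  + ring.
Qed.

(** Existence of [n] successive complex derivatives. The mean value property uses [n = 2]: the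
    second derivative serves only to make the first one continuous. *)
Fixpoint smooth (n : nat) (U : C -> Prop) (F : C -> C) : Prop :=
  match n with
  | O => True
  | S m => exists F1, (forall z, U z -> cder F z (F1 z)) /\ smooth m U F1
  end.

Lemma smooth_pred n U F : smooth (S n) U F -> smooth n U F.
Proof.
revert F; induction n as [|n IH]; intros F [F1 [H1 H2]]; [exact I|].
exists F1. split; [assumption|]. now apply IH.
Qed.

Lemma smooth_const n U c : smooth n U (fun _ => c).
Proof. revert c; induction n as [|n IH]; intros c; [exact I|]. exists (fun _ => RtoC 0). split; [intros z _; apply cder_const|apply IH]. Qed.

Lemma smooth_id n U : smooth n U (fun z => z).
Proof. destruct n as [|n]; [exact I|]. exists (fun _ => RtoC 1). split; [intros z _; apply cder_id|apply smooth_const]. Qed.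

Lemma smooth_plus n U F G : smooth n U F -> smooth n U G -> smooth n U (fun z => F z + G z)%C.
Proof.
revert F G; induction n as [|n IH]; intros F G; [easy|]. intros [F1 [HF HF1]] [G1 [HG HG1]].
exists (fun z => F1 z + G1 z)%C. split; [|now apply IH]. intros z Hz. apply cder_plus; auto.
Qed.

Lemma smooth_opp n U F : smooth n U F -> smooth n U (fun z => - F z)%C.
Proof.
revert F; induction n as [|n IH]; intros F; [easy|]. intros [F1 [HF HF1]].
exists (fun z => - F1 z)%C. split; [|now apply IH]. intros z Hz. apply cder_opp; auto.
Qed.

Lemma smooth_minus n U F G : smooth n U F -> smooth n U G -> smooth n U (fun z => F z - G z)%C.
Proof. intros HF HG. apply smooth_plus; [|apply smooth_opp]; assumption. Qed.

Lemma smooth_mult n U F G : smooth n U F -> smooth n U G -> smooth n U (fun z => F z * G z)%C.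
Proof.
revert F G; induction n as [|n IH]; intros F G; [easy|]. intros HF HG.
assert (PF := smooth_pred _ _ _ HF). assert (PG := smooth_pred _ _ _ HG).
destruct HF as [F1 [HF HF1]]. destruct HG as [G1 [HG HG1]].
exists (fun z => F1 z * G z + F z * G1 z)%C. split.
- intros z Hz. apply cder_mult; auto.
- apply smooth_plus; now apply IH.
Qed.

Lemma smooth_inv n U F : (forall z, U z -> F z <> RtoC 0) -> smooth n U F -> smooth n U (fun z => / F z)%C.
Proof.
intros H0. revert F H0; induction n as [|n IH]; intros F H0; [easy|]. intros HF.
assert (PF := smooth_pred _ _ _ HF).
destruct HF as [F1 [HF HF1]].
exists (fun z => - (/ F z * / F z) * F1 z)%C. split.
- intros z Hz. eapply cder_eq; [apply (cder_comp Cinv)|]; [apply cder_inv; auto|apply HF; auto|].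
  cbv beta. field. auto.
- apply smooth_mult; [|assumption]. apply smooth_opp, smooth_mult; now apply IH.
Qed.

Lemma smooth_Cexp n U F : smooth n U F -> smooth n U (fun z => Cexp (F z)).
Proof.
revert F; induction n as [|n IH]; intros F; [easy|]. intros HF.
assert (PF := smooth_pred _ _ _ HF).
destruct HF as [F1 [HF HF1]].
exists (fun z => Cexp (F z) * F1 z)%C. split.
- intros z Hz. apply (cder_comp Cexp); [apply cder_Cexp|auto].
- apply smooth_mult; auto.
Qed.

Lemma smooth_ext n (U : C -> Prop) F G : (forall z, U z -> exists r, 0 < r /\ forall w, Cmod (w - z) < r -> U w) ->
  (forall z, U z -> F z = G z) -> smooth n U F -> smooth n U G.
Proof.
destruct n as [|n]; intros HU HE; [easy|]. intros [F1 [H1 H2]]. exists F1. split; [|assumption].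
intros z Hz. destruct (HU z Hz) as (r & Hr & Hw). apply cder_ext with F r; auto.
Qed.

Lemma smooth_subset n (U V : C -> Prop) F : (forall z, V z -> U z) -> smooth n U F -> smooth n V F.
Proof.
intros HV. revert F; induction n as [|n IH]; intros F; [easy|]. intros [F1 [H1 H2]]. exists F1. auto.
Qed.

Lemma smooth_CPS n a : tame a -> smooth n unit_disk (CPS a).
Proof.
revert a; induction n as [|n IH]; intros a Ha; [exact I|].
exists (CPS (derived a)). split; [|now apply IH, tame_derived]. intros z Hz. now apply cder_CPS.
Qed.

Lemma unit_disk_open z : unit_disk z -> exists r, 0 < r /\ forall w, Cmod (w - z) < r -> unit_disk w.
Proof.
unfold unit_disk. intros Hz. exists (1 - Cmod z). split; [lra|]. intros w Hw.
assert (H := Cmod_triangle_inv w z). lra.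
Qed.

(** * Means of holomorphic functions over circles *)

Definition punctured_disk (z : C) : Prop := z <> RtoC 0 /\ unit_disk z.

Definition circ (r t : R) : C := (r * cos t, r * sin t).

Lemma Cmod_circ r t : 0 <= r -> Cmod (circ r t) = r.
Proof.
intros Hr. assert (H := Cmod_sqr (circ r t)). unfold circ, Re, Im in H; simpl in H.
assert (H1 := sin2_cos2 t). unfold Rsqr in H1.
replace (r * cos t * (r * cos t) + r * sin t * (r * sin t)) with (r * r * (sin t * sin t + cos t * cos t)) in H by ring.
rewrite H1 in H. assert (H2 := Cmod_ge_0 (circ r t)). unfold circ in *. nra.
Qed.

Lemma circ_punctured r t : 0 < r < 1 -> punctured_disk (circ r t).
Proof.
intros Hr. assert (H := Cmod_circ r t ltac:(lra)). split.
- intros E. rewrite E, Cmod_0 in H. lra.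
- unfold unit_disk. rewrite H. lra.
Qed.

Lemma derive_circ_r F u t l : cder F (circ u t) l ->
  is_derive (fun s => Re (F (circ s t))) u (Re (l * (cos t, sin t))).
Proof.
intros H. apply (cder_path F (fun s => circ s t)); [assumption| |]; unfold circ, Re, Im; simpl; auto_derive; try trivial; ring.
Qed.

Lemma derive_circ_t F r t l : cder F (circ r t) l ->
  is_derive (fun s => Re (F (circ r s))) t (Re (l * (- (r * sin t), r * cos t))) /\
  is_derive (fun s => Im (F (circ r s))) t (r * Re (l * (cos t, sin t))).
Proof.
intros H.
assert (H1 : is_derive (fun s => Re (circ r s)) t (- (r * sin t))) by (unfold circ, Re; simpl; auto_derive; try trivial; ring).
assert (H2 : is_derive (fun s => Im (circ r s)) t (r * cos t)) by (unfold circ, Im; simpl; auto_derive; try trivial; ring).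
split.
- now apply (cder_path F (fun s => circ r s)).
- eapply is_derive_eq; [apply (cder_path_Im F (fun s => circ r s)); eassumption|].
  unfold Re, Im, Cmult; simpl; ring.
Qed.

(** Joint continuity in radius and angle is what differentiation under the integral sign demands. *)
Lemma circ_continuity F u t : (forall eps, 0 < eps -> exists d, 0 < d /\ forall w, Cmod (w - circ u t) < d -> Cmod (F w - F (circ u t)) < eps) ->
  continuity_2d_pt (fun r s => Re (F (circ r s))) u t /\ continuity_2d_pt (fun r s => Im (F (circ r s))) u t.
Proof.
intros H.
assert (Hc : continuity_2d_pt (fun r s => r * cos s) u t).
{ apply (continuity_2d_pt_mult (fun r _ => r) (fun _ s => cos s)); [apply continuity_2d_pt_id1|].
  apply (continuity_1d_2d_pt_comp cos (fun _ s => s)); [apply continuity_cos|apply continuity_2d_pt_id2]. }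
assert (Hs : continuity_2d_pt (fun r s => r * sin s) u t).
{ apply (continuity_2d_pt_mult (fun r _ => r) (fun _ s => sin s)); [apply continuity_2d_pt_id1|].
  apply (continuity_1d_2d_pt_comp sin (fun _ s => s)); [apply continuity_sin|apply continuity_2d_pt_id2]. }
assert (Hm : forall eps : posreal, locally_2d (fun r s => Cmod (F (circ r s) - F (circ u t)) < eps) u t).
{ intros eps. destruct (H eps (cond_pos eps)) as (d & Hd & Hw).
  assert (Hd2 : 0 < d / 2) by lra.
  generalize (locally_2d_and _ _ _ _ (Hc (mkposreal _ Hd2)) (Hs (mkposreal _ Hd2))).
  apply locally_2d_impl, locally_2d_forall. intros r s [K1 K2]. simpl in K1, K2. apply Hw.
  eapply Rle_lt_trans; [apply Cmod_le_Re_Im|]. unfold circ, Re, Im; simpl. unfold Rminus in *. lra. }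
split; intros eps; generalize (Hm eps); apply locally_2d_impl, locally_2d_forall; intros r s K;
  (eapply Rle_lt_trans; [|exact K]).
- apply (re_le_Cmod (F (circ r s) - F (circ u t))).
- apply (Im_le_Cmod (F (circ r s) - F (circ u t))).
Qed.

(** Mean value property with a removable singularity at 0 of value [X]. By the polar Cauchy-Riemann
    equations the radial derivative of [Re G] is [1/r] times the angular derivative of [Im G], which
    integrates to 0 over a period. So the integral does not depend on the radius, and small radii
    give its value. *)
Lemma circle_mean G X : smooth 2 punctured_disk G ->
  (forall eps, 0 < eps -> exists d, 0 < d /\ forall z, 0 < Cmod z < d -> Cmod (G z - X) <= eps) ->
  forall r, 0 < r < 1 -> is_RInt (fun t => Re (G (circ r t))) 0 (2 * PI) (2 * PI * Re X).
Proof.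
intros [G1 [HG [G2 [HG1 _]]]] HX.
assert (HPI := PI_RGT_0).
set (K := fun w => (G1 w * w)%C).
assert (HcR : forall F F1, (forall z, punctured_disk z -> cder F z (F1 z)) -> forall r t, 0 < r < 1 -> continuous (fun s => Re (F (circ r s))) t).
{ intros F F1 HF r t Hr. apply (ex_derive_continuous (V:=R_NormedModule)). eexists.
  exact (proj1 (derive_circ_t F r t _ (HF _ (circ_punctured r t Hr)))). }
assert (HK : forall z, punctured_disk z -> cder K z (G2 z * z + G1 z * 1)%C).
{ intros z Hz. unfold K. apply (cder_mult G1 (fun w => w)); [auto|apply cder_id]. }
assert (HKc : forall r t, 0 < r -> Re (G1 (circ r t) * (cos t, sin t)) = Re (K (circ r t)) * / r).
{ intros r t Hr. unfold K, circ, Re, Cmult; simpl. field. lra. }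
assert (Hdr : forall r t, 0 < r < 1 -> is_derive (fun s => Re (G (circ s t))) r (Re (K (circ r t)) * / r)).
{ intros r t Hr. rewrite <- HKc by lra. apply derive_circ_r. now apply HG, circ_punctured. }
assert (Hint : forall r, 0 < r < 1 -> is_RInt (fun t => Re (K (circ r t)) * / r) 0 (2 * PI) 0).
{ intros r Hr.
  replace 0 with (minus (Im (G (circ r (2 * PI))) * / r) (Im (G (circ r 0)) * / r)) at 2.
  2:{ unfold circ. rewrite cos_2PI, sin_2PI, cos_0, sin_0. apply (minus_eq_zero (G:=R_AbelianGroup)). }
  apply (is_RInt_derive (V:=R_CompleteNormedModule) (fun t => Im (G (circ r t)) * / r)).
  - intros t _. destruct (derive_circ_t G r t (G1 (circ r t))) as [_ H]; [now apply HG, circ_punctured|].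
    rewrite HKc in H by lra.
    apply is_derive_ext with (fun s => / r * Im (G (circ r s))); [intros s; apply Rmult_comm|].
    eapply is_derive_eq; [apply is_derive_scal; exact H|]. rewrite <- Rmult_assoc, Rinv_l by lra. apply Rmult_1_l.
  - intros t _. apply (continuous_mult (K:=R_AbsRing)); [|apply continuous_const].
    now apply HcR with (fun z => G2 z * z + G1 z * 1)%C. }
assert (Hex : forall r, 0 < r < 1 -> ex_RInt (fun t => Re (G (circ r t))) 0 (2 * PI)).
{ intros r Hr. apply (ex_RInt_continuous (V:=R_CompleteNormedModule)). intros t _. now apply HcR with G1. }
assert (Hloc : forall r, 0 < r < 1 -> locally r (fun s => 0 < s < 1)).
{ intros r Hr. apply (open_and (fun s => 0 < s) (fun s => s < 1)); [apply open_gt|apply open_lt|exact Hr]. }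
assert (HJ : forall r, 0 < r < 1 -> is_derive (fun s => RInt (fun t => Re (G (circ s t))) 0 (2 * PI)) r 0).
{ intros r Hr. eapply is_derive_eq.
  - apply (is_derive_RInt_param (fun s t => Re (G (circ s t)))).
    + generalize (Hloc r Hr). apply filter_imp. intros s Hs t _. eexists. now apply Hdr.
    + intros t _. apply continuity_2d_pt_ext_loc with (fun s v => Re (K (circ s v)) * / s).
      * destruct (Hloc r Hr) as [d Hd]. exists d. intros s v Hs _. symmetry. apply is_derive_unique, Hdr, Hd, Hs.
      * apply (continuity_2d_pt_mult (fun s v => Re (K (circ s v))) (fun s _ => / s)).
        -- apply circ_continuity. eapply cder_cont, HK. now apply circ_punctured.
        -- apply (continuity_2d_pt_inv (fun s _ => s)); [apply continuity_2d_pt_id1|lra].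
    + generalize (Hloc r Hr). apply filter_imp. exact Hex.
  - apply is_RInt_unique. apply is_RInt_ext with (fun t => Re (K (circ r t)) * / r); [|now apply Hint].
    intros t _. symmetry. now apply is_derive_unique, Hdr. }
assert (Hconst : forall r s, 0 < r <= s -> s < 1 -> RInt (fun t => Re (G (circ r t))) 0 (2 * PI) = RInt (fun t => Re (G (circ s t))) 0 (2 * PI)).
{ intros r s Hrs Hs. apply (const_of_derive_0 (fun r => RInt (fun t => Re (G (circ r t))) 0 (2 * PI)) (fun _ => 0)); [lra| |reflexivity].
  intros t Ht. apply HJ. lra. }
intros r Hr.
replace (2 * PI * Re X) with (RInt (fun t => Re (G (circ r t))) 0 (2 * PI)); [now apply (RInt_correct (V:=R_CompleteNormedModule)), Hex|].
apply cond_eq. intros eps He.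
destruct (HX (eps / (4 * PI))) as (d & Hd & Hz). { apply Rdiv_lt_0_compat; lra. }
set (s := Rmin r (d / 2)).
assert (Hs : 0 < s <= r /\ s < d).
{ unfold s. assert (H1 := Rmin_l r (d / 2)). assert (H2 := Rmin_r r (d / 2)). repeat split; [apply Rmin_pos|..]; lra. }
rewrite <- (Hconst s r) by lra.
replace (RInt (fun t => Re (G (circ s t))) 0 (2 * PI) - 2 * PI * Re X) with (RInt (fun t => Re (G (circ s t)) - Re X) 0 (2 * PI)).
2:{ rewrite (RInt_minus (V:=R_CompleteNormedModule)); [|apply Hex; lra|apply ex_RInt_const].
    rewrite RInt_const. unfold minus, plus, opp, scal; simpl. unfold mult; simpl. ring. }
eapply Rle_lt_trans; [apply abs_RInt_le_const with (M := eps / (4 * PI))|].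
- lra.
- apply (ex_RInt_minus (V:=R_CompleteNormedModule)); [apply Hex; lra|apply ex_RInt_const].
- intros t _. eapply Rle_trans; [apply (re_le_Cmod (G (circ s t) - X))|]. apply Hz. rewrite Cmod_circ; lra.
- replace ((2 * PI - 0) * (eps / (4 * PI))) with (eps / 2) by (field; lra). lra.
Qed.

(** * Riesz inequality *)

Definition jet3 (F : C -> C) (c0 c1 c2 c3 : C) : Prop :=
  exists K d, 0 < d /\ 0 <= K /\ forall z, Cmod z < d ->
    Cmod (F z - (c0 + c1 * z + c2 * (z * z) + c3 * (z * z * z))) <= K * Cmod z ^ 4.

Lemma poly3_bound k0 k1 k2 k3 z : Cmod z <= 1 ->
  Cmod (k0 + k1 * z + k2 * (z * z) + k3 * (z * z * z)) <= Cmod k0 + Cmod k1 + Cmod k2 + Cmod k3.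
Proof.
intros Hz. assert (H0 := Cmod_ge_0 z).
assert (H1 := Cmod_ge_0 k1). assert (H2 := Cmod_ge_0 k2). assert (H3 := Cmod_ge_0 k3).
assert (Hzz : 0 <= Cmod z * Cmod z <= 1) by nra.
assert (Hzzz : 0 <= Cmod z * Cmod z * Cmod z <= 1) by nra.
repeat (eapply Rle_trans; [apply Cmod_triangle|]; apply Rplus_le_compat); rewrite ?Cmod_mult; try lra; nra.
Qed.

Lemma exists_phase z : exists lam, Cmod lam = 1 /\ (lam * z)%C = RtoC (Cmod z).
Proof.
destruct (Ceq_dec z (RtoC 0)) as [-> | Hz].
- exists (RtoC 1). split; [apply Cmod_1|]. rewrite Cmod_0. ring.
- assert (Hm : 0 < Cmod z) by now apply Cmod_gt_0.
  exists (Cconj z / RtoC (Cmod z))%C.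
  assert (Hn : RtoC (Cmod z) <> RtoC 0) by (intros E; apply RtoC_inj in E; lra).
  split.
  + rewrite Cmod_div, Cmod_conj, Cmod_R, Rabs_pos_eq by (assumption || lra). field. lra.
  + replace (Cconj z / RtoC (Cmod z) * z)%C with ((z * Cconj z) / RtoC (Cmod z))%C by (field; assumption).
    rewrite <- Cmod2_conj. replace (RtoC (Cmod z ^ 2)) with (RtoC (Cmod z) * RtoC (Cmod z))%C; [now field|].
    rewrite <- RtoC_mult. f_equal. ring.
Qed.

(** On a circle a cross term [z^i conj(z)^j] with [i > j] equals [r^(2j) z^(i-j)]. So [|P|^2] is its
    mean plus the real part of a polynomial vanishing at 0, which a holomorphic correction can
    cancel. *)
Lemma Cmod_quadratic_sqr a b z :
  let P := (1 + a * z + b * (z * z))%C in let r2 := Re z * Re z + Im z * Im z in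
  Cmod P * Cmod P = 1 + Cmod a ^ 2 * r2 + Cmod b ^ 2 * (r2 * r2) +
    2 * Re (a * z + b * (z * z) + Cconj a * b * RtoC r2 * z).
Proof.
cbv zeta. rewrite Cmod_sqr, (Cmod2_alt a), (Cmod2_alt b).
destruct a as [a1 a2], b as [b1 b2], z as [x y].
unfold Re, Im, Cmult, Cplus, Cconj, RtoC; simpl; ring.
Qed.

(** On a circle negative powers are multiples of conjugates of positive ones; under [Re] they can
    therefore be traded for positive powers. *)
Lemma Cinv_circle z r : 0 < r -> Cmod z = r -> (/ z)%C = (Cconj z * RtoC (/ (r * r)))%C.
Proof.
intros Hr Hz. assert (Hz0 : z <> RtoC 0) by (intros ->; rewrite Cmod_0 in Hz; lra).
assert (H := Cmod2_conj z). rewrite Hz in H. replace (r ^ 2) with (r * r) in H by ring.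
assert (Hn : RtoC (r * r) <> RtoC 0) by (intros E; apply RtoC_inj in E; nra).
rewrite RtoC_inv by nra. rewrite H in Hn |- *.
field. split; [|assumption]. intros E. rewrite E, Cmult_0_r in Hn. now apply Hn.
Qed.

Lemma Re_conj_swap u v : Re (u * Cconj v) = Re (Cconj u * v).
Proof. destruct u, v. unfold Re, Cmult, Cconj; simpl; ring. Qed.

Lemma Re_plus z w : Re (z + w) = Re z + Re w. Proof. reflexivity. Qed.

Lemma Re_minus z w : Re (z - w) = Re z - Re w. Proof. reflexivity. Qed.

Lemma Re_scal (x : R) z : Re (RtoC x * z) = x * Re z.
Proof. destruct z. unfold Re, Cmult, RtoC; simpl; ring. Qed.

(** The third-order jet at 0 stands in for a power series of [w]. *)
Definition bounded_jet (w : C -> C) (c1 c2 c3 : C) : Prop :=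
  smooth 2 unit_disk w /\ (forall z, unit_disk z -> Cmod (w z) <= 1) /\ jet3 w (RtoC 0) c1 c2 c3.

(* On [|z| = r] the real part of the integrand is at most [|P|^2 / r^3]; the terms
   [s1 z + s2 z^2] and the subtracted principal part remove everything of
   [|P|^2 / r^3] but its mean. *)
Lemma riesz_circle w c1 c2 c3 a b r : bounded_jet w c1 c2 c3 -> 0 < r < 1 ->
  Cmod (c3 + 2 * a * c2 + c1 * (2 * b + a * a)) * r ^ 3 <= 1 + Cmod a ^ 2 * r ^ 2 + Cmod b ^ 2 * r ^ 4.
Proof.
intros (w_smooth & w_bound & w_jet) Hr. set (X := (c3 + 2 * a * c2 + c1 * (2 * b + a * a))%C).
destruct (exists_phase X) as (lam & Hlam & HX).
set (P := fun z => (1 + a * z + b * (z * z))%C).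
(* [u] and [v] are [lam] times the coefficients of [z] and [z^2] in [w P^2], so they form the
   principal part after division by [z^3]; the constant term is then [lam * X]. In [s1] and [s2] the
   first summand comes from [|P|^2] and the second from rewriting the principal part on the
   circle. *)
set (u := (lam * c1)%C). set (v := (lam * (c2 + 2 * a * c1))%C).
set (s1 := (RtoC (2 / r ^ 3) * (a + Cconj a * b * RtoC (r * r)) - Cconj v * RtoC (/ (r * r)))%C).
set (s2 := (RtoC (2 / r ^ 3) * b - Cconj u * RtoC (/ (r * r) * / (r * r)))%C).
set (G := fun z => (lam * w z * (P z * P z) * (/ z * / z * / z) - u * (/ z * / z) - v * / z - (s1 * z + s2 * (z * z)))%C).
assert (HG : smooth 2 punctured_disk G).
{ assert (Hid := smooth_id 2 punctured_disk). assert (Hc := smooth_const 2 punctured_disk).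
  assert (Hi : smooth 2 punctured_disk Cinv) by (apply (smooth_inv 2 _ (fun z => z)); [now intros z []|assumption]).
  assert (Hw : smooth 2 punctured_disk w) by (apply smooth_subset with unit_disk; [now intros z []|assumption]).
  assert (HP : smooth 2 punctured_disk P) by (unfold P; repeat first [apply smooth_plus | apply smooth_mult]; auto).
  unfold G. repeat first [apply smooth_minus | apply smooth_plus | apply smooth_mult]; auto. }
assert (Hlim : forall eps, 0 < eps -> exists d, 0 < d /\ forall z, 0 < Cmod z < d -> Cmod (G z - lam * X) <= eps).
{ intros eps He. destruct w_jet as (K & d & Hd & HK & Hj).
  (* [k0] to [k3] come from the coefficients of [z^4] to [z^7] in the product of the jet with [P^2],
     corrected by [s1] and [s2]. They form the part of [G z - lam * X] that is divisible by [z]. *)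
  set (k0 := (lam * (c1 * (2 * a * b) + c2 * (a * a + 2 * b) + c3 * (2 * a)) - s1)%C).
  set (k1 := (lam * (c1 * (b * b) + c2 * (2 * a * b) + c3 * (a * a + 2 * b)) - s2)%C).
  set (k2 := (lam * (c2 * (b * b) + c3 * (2 * a * b)))%C).
  set (k3 := (lam * (c3 * (b * b)))%C).
  set (B := Cmod 1 + Cmod a + Cmod b + Cmod 0).
  set (M := K * (B * B) + (Cmod k0 + Cmod k1 + Cmod k2 + Cmod k3)).
  assert (HB : 0 <= B) by (unfold B; generalize (Cmod_ge_0 1) (Cmod_ge_0 a) (Cmod_ge_0 b) (Cmod_ge_0 0); lra).
  assert (HM : 0 <= M).
  { unfold M. generalize (Cmod_ge_0 k0) (Cmod_ge_0 k1) (Cmod_ge_0 k2) (Cmod_ge_0 k3).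
    assert (0 <= K * (B * B)) by (apply Rmult_le_pos; nra). lra. }
  exists (Rmin (Rmin 1 d) (eps / (M + 1))). split.
  { repeat apply Rmin_pos; try lra. apply Rdiv_lt_0_compat; lra. }
  intros z [Hz0 Hz].
  assert (Hz1 : Cmod z < 1) by (eapply Rlt_le_trans; [exact Hz|]; eapply Rle_trans; [apply Rmin_l|apply Rmin_l]).
  assert (Hz2 : Cmod z < d) by (eapply Rlt_le_trans; [exact Hz|]; eapply Rle_trans; [apply Rmin_l|apply Rmin_r]).
  assert (Hz3 : Cmod z * (M + 1) < eps) by (apply <- Rlt_div_r; [eapply Rlt_le_trans; [exact Hz|apply Rmin_r]|lra]).
  assert (Hzn : z <> RtoC 0) by (intros ->; rewrite Cmod_0 in Hz0; lra).
  set (E := (w z - (RtoC 0 + c1 * z + c2 * (z * z) + c3 * (z * z * z)))%C).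
  assert (HE : Cmod E <= K * Cmod z ^ 4) by now apply Hj.
  replace (G z - lam * X)%C with (lam * E * (P z * P z) * (/ z * / z * / z) + z * (k0 + k1 * z + k2 * (z * z) + k3 * (z * z * z)))%C.
  2:{ unfold G, E, P, k0, k1, k2, k3, X, u, v. field. assumption. }
  assert (HP : Cmod (P z) <= B).
  { unfold B, P. replace (1 + a * z + b * (z * z))%C with (1 + a * z + b * (z * z) + 0 * (z * z * z))%C by ring. apply poly3_bound. lra. }
  assert (T1 : Cmod (lam * E * (P z * P z) * (/ z * / z * / z)) <= K * (B * B) * Cmod z).
  { rewrite !Cmod_mult, Hlam, !Cmod_inv by assumption.
    assert (HPP : Cmod (P z) * Cmod (P z) <= B * B) by (apply Rmult_le_compat; try apply Cmod_ge_0; assumption).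
    replace (K * (B * B) * Cmod z) with (K * Cmod z ^ 4 * (B * B) * (/ Cmod z * / Cmod z * / Cmod z)) by (field; lra).
    assert (0 < / Cmod z) by now apply Rinv_0_lt_compat.
    apply Rmult_le_compat_r; [apply Rmult_le_pos; nra|]. rewrite Rmult_1_l.
    apply Rmult_le_compat; try assumption; [apply Cmod_ge_0|]. apply Rmult_le_pos; apply Cmod_ge_0. }
  assert (T2 : Cmod (z * (k0 + k1 * z + k2 * (z * z) + k3 * (z * z * z))) <= (Cmod k0 + Cmod k1 + Cmod k2 + Cmod k3) * Cmod z).
  { rewrite Cmod_mult, Rmult_comm. apply Rmult_le_compat_r; [lra|]. apply poly3_bound. lra. }
  eapply Rle_trans; [apply Cmod_triangle|]. unfold M in Hz3. lra. }
assert (Hint := circle_mean G (lam * X) HG Hlim r Hr).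
set (N := 1 + Cmod a ^ 2 * r ^ 2 + Cmod b ^ 2 * r ^ 4).
assert (HPI := PI_RGT_0).
assert (Hr3 : 0 < r ^ 3) by (apply pow_lt; lra).
assert (Hle : forall t, Re (G (circ r t)) <= N / r ^ 3).
{ intros t. set (z := circ r t). assert (Hz : Cmod z = r) by (apply Cmod_circ; lra).
  assert (Hr2 : r * r = Re z * Re z + Im z * Im z) by (rewrite <- Hz; apply Cmod_sqr).
  assert (HP := Cmod_quadratic_sqr a b z). cbv zeta in HP. fold (P z) in HP.
  rewrite <- Hr2 in HP.
  assert (HA : Re (lam * w z * (P z * P z) * (/ z * / z * / z)) <= Cmod (P z) * Cmod (P z) * / r ^ 3).
  { eapply Rle_trans; [apply Re_le_Cmod|].
    rewrite !Cmod_mult, Hlam, !Cmod_inv, Hz by (intros E; rewrite E, Cmod_0 in Hz; lra).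
    replace (/ r * / r * / r) with (/ r ^ 3) by (field; lra).
    apply Rmult_le_compat_r; [left; now apply Rinv_0_lt_compat|].
    assert (Hw : Cmod (w z) <= 1) by (apply w_bound; unfold unit_disk; lra).
    assert (0 <= Cmod (P z) * Cmod (P z)) by (apply Rmult_le_pos; apply Cmod_ge_0). nra. }
  assert (HB : Re (u * (/ z * / z)) + Re (v * / z) + Re (s1 * z + s2 * (z * z)) =
     2 / r ^ 3 * Re (a * z + b * (z * z) + Cconj a * b * RtoC (r * r) * z)).
  { rewrite (Cinv_circle z r) by lra.
    replace (u * (Cconj z * RtoC (/ (r * r)) * (Cconj z * RtoC (/ (r * r)))))%C
      with (RtoC (/ (r * r) * / (r * r)) * (u * Cconj (z * z)))%C by (rewrite Cmult_conj, RtoC_mult; ring).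
    replace (v * (Cconj z * RtoC (/ (r * r))))%C with (RtoC (/ (r * r)) * (v * Cconj z))%C by ring.
    replace (s1 * z + s2 * (z * z))%C with (RtoC (2 / r ^ 3) * (a * z + b * (z * z) + Cconj a * b * RtoC (r * r) * z)
      - RtoC (/ (r * r)) * (Cconj v * z) - RtoC (/ (r * r) * / (r * r)) * (Cconj u * (z * z)))%C by (unfold s1, s2; ring).
    rewrite !Re_minus, !Re_scal, (Re_conj_swap u), (Re_conj_swap v). ring. }
  unfold G. rewrite !Re_minus.
  replace (N / r ^ 3) with (Cmod (P z) * Cmod (P z) * / r ^ 3 - 2 / r ^ 3 * Re (a * z + b * (z * z) + Cconj a * b * RtoC (r * r) * z)).
  - lra.
  - rewrite HP. unfold N. field. lra. }
assert (Hfin : 2 * PI * Re (lam * X) <= (2 * PI - 0) * (N / r ^ 3)).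
{ rewrite <- (is_RInt_unique _ _ _ _ Hint).
  replace ((2 * PI - 0) * (N / r ^ 3)) with (RInt (fun _ => N / r ^ 3) 0 (2 * PI)) by (now rewrite RInt_const).
  apply RInt_le; [lra|eexists; exact Hint|apply ex_RInt_const|]. intros t _. apply Hle. }
rewrite HX in Hfin. change (Re (RtoC (Cmod X))) with (Cmod X) in Hfin.
apply Rmult_le_reg_r with (/ r ^ 3); [now apply Rinv_0_lt_compat|].
rewrite Rmult_assoc, Rinv_r, Rmult_1_r by lra. fold (N / r ^ 3).
apply Rmult_le_reg_l with (2 * PI); lra.
Qed.

Lemma riesz_inequality w c1 c2 c3 a b : bounded_jet w c1 c2 c3 ->
  Cmod (c3 + 2 * a * c2 + c1 * (2 * b + a * a)) <= 1 + Cmod a ^ 2 + Cmod b ^ 2.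
Proof.
intros Hw. set (X := Cmod _). set (N := 1 + Cmod a ^ 2 + Cmod b ^ 2).
assert (Ha := pow2_ge_0 (Cmod a)). assert (Hb := pow2_ge_0 (Cmod b)).
assert (HN : 1 <= N) by (unfold N; lra).
destruct (Rle_lt_dec X N) as [H | H]; [exact H|exfalso].
(* Since [(1 - e)^3 >= 1 - 3 e], this choice makes the loss on the left at radius [1 - e] at most
   half of the gap [X - N], so the inequality on that circle already fails. *)
set (e := (X - N) / (6 * X)).
assert (HeX : e * X = (X - N) / 6) by (unfold e; field; lra).
assert (He0 : 0 < e) by (apply Rdiv_lt_0_compat; lra).
assert (He : 0 < e < 1 / 2) by (split; [lra|]; apply Rmult_lt_reg_r with X; lra).
assert (Hr := riesz_circle w c1 c2 c3 a b (1 - e) Hw ltac:(lra)). fold X in Hr.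
assert (H2 : 0 <= (1 - e) ^ 2 <= 1) by (simpl; nra).
assert (H3 : 1 - 3 * e <= (1 - e) ^ 3) by (simpl; nra).
assert (H4 : (1 - e) ^ 4 <= 1) by (replace ((1 - e) ^ 4) with ((1 - e) ^ 2 * (1 - e) ^ 2) by ring; nra).
assert (H5 : Cmod a ^ 2 * (1 - e) ^ 2 <= Cmod a ^ 2) by nra.
assert (H6 : Cmod b ^ 2 * (1 - e) ^ 4 <= Cmod b ^ 2) by nra.
assert (H7 : X * (1 - 3 * e) <= X * (1 - e) ^ 3) by (apply Rmult_le_compat_l; lra).
unfold N in *. nra.
Qed.

(** Multiplication by [z] moves lower coefficients into third place, so that the one inequality of
    Riesz also yields the bounds on [c1] and [c2]. *)
Lemma bounded_jet_shift w c1 c2 c3 : bounded_jet w c1 c2 c3 -> bounded_jet (fun z => z * w z)%C (RtoC 0) c1 c2.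
Proof.
intros (Hs & Hb & K & d & Hd & HK & Hj). repeat split.
- apply smooth_mult; [apply smooth_id|assumption].
- intros z Hz. rewrite Cmod_mult. specialize (Hb z Hz). unfold unit_disk in Hz.
  assert (H0 := Cmod_ge_0 z). assert (H1 := Cmod_ge_0 (w z)). nra.
- exists (K + Cmod c3), (Rmin d 1). split; [apply Rmin_pos; lra|]. assert (H3 := Cmod_ge_0 c3). split; [lra|].
  intros z Hz. assert (Hz1 := Rlt_le_trans _ _ _ Hz (Rmin_l _ _)). assert (Hz2 := Rlt_le_trans _ _ _ Hz (Rmin_r _ _)).
  specialize (Hj z Hz1).
  replace (z * w z - (0 + 0 * z + c1 * (z * z) + c2 * (z * z * z)))%C
    with (z * (w z - (0 + c1 * z + c2 * (z * z) + c3 * (z * z * z))) + c3 * (z * z * z * z))%C by ring.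
  eapply Rle_trans; [apply Cmod_triangle|]. rewrite !Cmod_mult.
  assert (H0 := Cmod_ge_0 z). set (e := Cmod (w z - _)) in *. assert (He : 0 <= e) by apply Cmod_ge_0.
  assert (Cmod z * e <= 1 * (K * Cmod z ^ 4)) by (apply Rmult_le_compat; try apply Cmod_ge_0; lra).
  replace (Cmod z * Cmod z * Cmod z * Cmod z) with (Cmod z ^ 4) by ring. lra.
Qed.

Lemma schwarz_coef1 w c1 c2 c3 : bounded_jet w c1 c2 c3 -> Cmod c1 <= 1.
Proof.
intros H. assert (R := riesz_inequality _ _ _ _ 0 0 (bounded_jet_shift _ _ _ _ (bounded_jet_shift _ _ _ _ H))).
rewrite Cmod_0 in R. replace (c1 + 2 * 0 * 0 + 0 * (2 * 0 + 0 * 0))%C with c1 in R by ring. lra.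
Qed.

Lemma Cconj_mult_self z : (z * Cconj z)%C = RtoC (Cmod z * Cmod z).
Proof. rewrite <- Cmod2_conj. f_equal. ring. Qed.

(** After one shift Riesz reads [|c2 + 2 a c1| <= 1 + |a|^2]. Let [lam] rotate the functional to a
    positive number and [a = conj (lam c1)], [x = |c1|]: then [lam * 2 a c1 = 2 x^2], and the
    functional is at most [1 + x^2 - 2 x^2 + k x^2 <= 1]. *)
Lemma schwarz_coef2 w c1 c2 c3 (k : R) : bounded_jet w c1 c2 c3 -> 0 <= k <= 1 ->
  Cmod (c2 + RtoC k * (c1 * c1)) <= 1.
Proof.
intros H Hk. set (T := (c2 + RtoC k * (c1 * c1))%C). destruct (exists_phase T) as (lam & Hlam & HT).
set (a := Cconj (lam * c1)).
assert (Ha : Cmod a = Cmod c1) by (unfold a; rewrite Cmod_conj, Cmod_mult, Hlam; ring).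
assert (R := riesz_inequality _ _ _ _ a 0 (bounded_jet_shift _ _ _ _ H)).
rewrite Cmod_0, Ha in R. set (X := (c2 + 2 * a * c1 + 0 * (2 * 0 + a * a))%C) in R.
change (Cmod T) with (Re (RtoC (Cmod T))). rewrite <- HT.
replace (lam * T)%C with (lam * X - RtoC 2 * ((lam * c1) * Cconj (lam * c1)) + RtoC k * (lam * (c1 * c1)))%C
  by (unfold X, T, a; ring).
rewrite Cconj_mult_self, Re_plus, Re_minus, !Re_scal.
rewrite (Cmod_mult lam c1), Hlam, Rmult_1_l. change (Re (RtoC (Cmod c1 * Cmod c1))) with (Cmod c1 * Cmod c1).
assert (H1 := Re_le_Cmod (lam * X)). assert (H2 := Re_le_Cmod (lam * (c1 * c1))).
rewrite !Cmod_mult, Hlam in H1. rewrite !Cmod_mult, Hlam in H2. set (x := Cmod c1) in *.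
assert (H3 : k * Re (lam * (c1 * c1)) <= k * (x * x)) by (apply Rmult_le_compat_l; lra).
assert (H4 : k * (x * x) <= 1 * (x * x)) by (apply Rmult_le_compat_r; [nra|lra]).
simpl in *. lra.
Qed.

(** [a = mu/2 c1] reproduces [mu c1 c2] and part of the cubic term; [b = conj (lam c1)] contributes
    [2 x^2] against its cost [x^2], where [x = |c1|]. What remains is
    [1 + (mu^2/4 - 1) x^2 + |D| x^3] with [D = nu - mu^2/4], and [x <= 1] reduces this to the
    hypothesis on [mu] and [nu]. *)
Lemma schwarz_coef3 w c1 c2 c3 (mu nu : R) : bounded_jet w c1 c2 c3 -> mu ^ 2 / 4 + Rabs (nu - mu ^ 2 / 4) <= 1 ->
  Cmod (c3 + RtoC mu * (c1 * c2) + RtoC nu * (c1 * c1 * c1)) <= 1.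
Proof.
intros H Hk. set (T := (c3 + _ + _)%C). destruct (exists_phase T) as (lam & Hlam & HT).
assert (Hx1 := schwarz_coef1 _ _ _ _ H). assert (Hx := Cmod_ge_0 c1).
set (a := (RtoC (mu / 2) * c1)%C). set (b := Cconj (lam * c1)).
assert (Ha : Cmod a ^ 2 = mu ^ 2 / 4 * Cmod c1 ^ 2).
{ unfold a. rewrite Cmod_mult, Rpow_mult_distr, Cmod_R, pow2_abs. field. }
assert (Hb : Cmod b = Cmod c1) by (unfold b; rewrite Cmod_conj, Cmod_mult, Hlam; ring).
assert (R := riesz_inequality _ _ _ _ a b H).
rewrite Ha, Hb in R. set (X := (c3 + 2 * a * c2 + c1 * (2 * b + a * a))%C) in R.
set (D := nu - mu ^ 2 / 4) in *.
change (Cmod T) with (Re (RtoC (Cmod T))). rewrite <- HT.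
replace (lam * T)%C with (lam * X - RtoC 2 * ((lam * c1) * Cconj (lam * c1)) + lam * (RtoC D * (c1 * c1 * c1)))%C.
2:{ unfold X, T, a, b, D. replace (nu - mu ^ 2 / 4) with (nu - mu / 2 * (mu / 2)) by field.
    replace (RtoC mu) with (RtoC 2 * RtoC (mu / 2))%C by (rewrite <- RtoC_mult; f_equal; field).
    rewrite RtoC_minus, RtoC_mult. ring. }
rewrite Cconj_mult_self, Re_plus, Re_minus, !Re_scal.
rewrite (Cmod_mult lam c1), Hlam, Rmult_1_l. change (Re (RtoC (Cmod c1 * Cmod c1))) with (Cmod c1 * Cmod c1).
assert (H1 := Re_le_Cmod (lam * X)). assert (H2 := Re_le_Cmod (lam * (RtoC D * (c1 * c1 * c1)))).
rewrite Cmod_mult, Hlam in H1. rewrite !Cmod_mult, Hlam, Cmod_R in H2.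
assert (HD := Rabs_pos D). set (x := Cmod c1) in *.
assert (H3 : Rabs D * (x * x * x) <= Rabs D * (x * x)) by (apply Rmult_le_compat_l; nra).
assert (H4 : (mu ^ 2 / 4 + Rabs D) * (x * x) <= 1 * (x * x)) by (apply Rmult_le_compat_r; nra).
simpl in *. lra.
Qed.

(** * Third-order expansions at the origin *)

Lemma jet3_ext F G c0 c1 c2 c3 r : 0 < r -> (forall z, Cmod z < r -> F z = G z) -> jet3 F c0 c1 c2 c3 -> jet3 G c0 c1 c2 c3.
Proof.
intros Hr HE (K & d & Hd & HK & H). exists K, (Rmin r d). split; [apply Rmin_pos; lra|]. split; [assumption|].
intros z Hz. rewrite <- HE by (eapply Rlt_le_trans; [exact Hz|apply Rmin_l]). apply H.
eapply Rlt_le_trans; [exact Hz|apply Rmin_r].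
Qed.

Lemma jet3_eq F c0 c1 c2 c3 d0 d1 d2 d3 : jet3 F c0 c1 c2 c3 -> c0 = d0 -> c1 = d1 -> c2 = d2 -> c3 = d3 -> jet3 F d0 d1 d2 d3.
Proof. now intros H <- <- <- <-. Qed.

Lemma jet3_poly k0 k1 k2 k3 : jet3 (fun z => k0 + k1 * z + k2 * (z * z) + k3 * (z * z * z))%C k0 k1 k2 k3.
Proof.
exists 0, 1. repeat split; try lra. intros z _. replace (_ - _)%C with (RtoC 0) by ring. rewrite Cmod_0. lra.
Qed.

Lemma jet3_plus F G c0 c1 c2 c3 d0 d1 d2 d3 : jet3 F c0 c1 c2 c3 -> jet3 G d0 d1 d2 d3 ->
  jet3 (fun z => F z + G z)%C (c0 + d0) (c1 + d1) (c2 + d2) (c3 + d3).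
Proof.
intros (K & d & Hd & HK & H) (L & e & He & HL & H'). exists (K + L), (Rmin d e).
split; [apply Rmin_pos; lra|]. split; [lra|]. intros z Hz.
specialize (H z ltac:(eapply Rlt_le_trans; [exact Hz|apply Rmin_l])).
specialize (H' z ltac:(eapply Rlt_le_trans; [exact Hz|apply Rmin_r])).
match type of H with Cmod ?x <= _ => match type of H' with Cmod ?y <= _ =>
  replace (F z + G z - (c0 + d0 + (c1 + d1) * z + (c2 + d2) * (z * z) + (c3 + d3) * (z * z * z)))%C with (x + y)%C by ring end end.
eapply Rle_trans; [apply Cmod_triangle|]. lra.
Qed.

Lemma jet3_mult F G c0 c1 c2 c3 d0 d1 d2 d3 : jet3 F c0 c1 c2 c3 -> jet3 G d0 d1 d2 d3 ->
  jet3 (fun z => F z * G z)%C (c0 * d0) (c0 * d1 + c1 * d0) (c0 * d2 + c1 * d1 + c2 * d0) (c0 * d3 + c1 * d2 + c2 * d1 + c3 * d0).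
Proof.
intros (K & d & Hd & HK & H) (L & e & He & HL & H').
set (Bc := Cmod c0 + Cmod c1 + Cmod c2 + Cmod c3). set (Bd := Cmod d0 + Cmod d1 + Cmod d2 + Cmod d3).
set (h0 := (c1 * d3 + c2 * d2 + c3 * d1)%C). set (h1 := (c2 * d3 + c3 * d2)%C). set (h2 := (c3 * d3)%C).
set (Bh := Cmod h0 + Cmod h1 + Cmod h2 + Cmod 0).
assert (HBc : 0 <= Bc) by (unfold Bc; generalize (Cmod_ge_0 c0) (Cmod_ge_0 c1) (Cmod_ge_0 c2) (Cmod_ge_0 c3); lra).
assert (HBd : 0 <= Bd) by (unfold Bd; generalize (Cmod_ge_0 d0) (Cmod_ge_0 d1) (Cmod_ge_0 d2) (Cmod_ge_0 d3); lra).
assert (HBh : 0 <= Bh) by (unfold Bh; generalize (Cmod_ge_0 h0) (Cmod_ge_0 h1) (Cmod_ge_0 h2) (Cmod_ge_0 0); lra).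
exists (Bc * L + K * Bd + K * L + Bh), (Rmin 1 (Rmin d e)).
split; [repeat apply Rmin_pos; lra|].
assert (0 <= Bc * L) by (apply Rmult_le_pos; lra). assert (0 <= K * Bd) by (apply Rmult_le_pos; lra).
assert (0 <= K * L) by (apply Rmult_le_pos; lra).
split; [lra|]. intros z Hz.
assert (Hz1 := Rlt_le_trans _ _ _ Hz (Rmin_l _ _)). assert (Hz2 := Rlt_le_trans _ _ _ Hz (Rmin_r _ _)).
specialize (H z ltac:(eapply Rlt_le_trans; [exact Hz2|apply Rmin_l])).
specialize (H' z ltac:(eapply Rlt_le_trans; [exact Hz2|apply Rmin_r])).
set (p := (c0 + c1 * z + c2 * (z * z) + c3 * (z * z * z))%C) in *.
set (q := (d0 + d1 * z + d2 * (z * z) + d3 * (z * z * z))%C) in *.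
assert (Hp : Cmod p <= Bc) by (apply poly3_bound; lra).
assert (Hq : Cmod q <= Bd) by (apply poly3_bound; lra).
assert (Hh : Cmod (h0 + h1 * z + h2 * (z * z) + 0 * (z * z * z)) <= Bh) by (apply poly3_bound; lra).
set (h := (h0 + _ + _ + _)%C) in Hh.
replace (F z * G z - _)%C with (p * (G z - q) + (F z - p) * q + (F z - p) * (G z - q) + h * (z * z * z * z))%C
  by (unfold p, q, h, h0, h1, h2; ring).
assert (Hz0 := Cmod_ge_0 z). set (m := Cmod z ^ 4) in *.
assert (Hm : 0 <= m <= 1). { split; [apply pow_le; lra|]. rewrite <- (pow1 4). apply pow_incr. lra. }
set (x := Cmod (F z - p)) in *. set (y := Cmod (G z - q)) in *.
assert (Hx : 0 <= x) by apply Cmod_ge_0. assert (Hy : 0 <= y) by apply Cmod_ge_0.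
assert (T1 : Cmod p * y <= Bc * (L * m)) by (apply Rmult_le_compat; try assumption; apply Cmod_ge_0).
assert (T2 : x * Cmod q <= K * m * Bd) by (apply Rmult_le_compat; try assumption; apply Cmod_ge_0).
assert (T3 : x * y <= K * m * L) by (apply Rmult_le_compat; try assumption; nra).
assert (T4 : Cmod h * m <= Bh * m) by (apply Rmult_le_compat_r; lra).
eapply Rle_trans; [apply Cmod_triangle|]. rewrite (Cmod_mult h), !Cmod_mult.
replace (Cmod z * Cmod z * Cmod z * Cmod z) with m by (unfold m; ring).
eapply Rle_trans; [apply Rplus_le_compat_r, Cmod_triangle|].
eapply Rle_trans; [apply Rplus_le_compat_r, Rplus_le_compat_r, Cmod_triangle|].
rewrite !Cmod_mult. fold x y. lra.
Qed.

Lemma jet3_scal k F c0 c1 c2 c3 : jet3 F c0 c1 c2 c3 -> jet3 (fun z => k * F z)%C (k * c0) (k * c1) (k * c2) (k * c3).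
Proof.
intros H. assert (J := jet3_mult _ _ _ _ _ _ _ _ _ _ (jet3_poly k 0 0 0) H).
apply jet3_ext with (r := 1) (G := fun z => (k * F z)%C) in J; [|lra|intros z _; ring].
eapply jet3_eq; [exact J|ring..].
Qed.

(** [F] times the proposed polynomial has jet [1, 0, 0, 0] by the product rule. Dividing by [F],
    whose modulus is at least 1/2 near 0, at most doubles the error. *)
Lemma jet3_inv F c1 c2 c3 : jet3 F 1 c1 c2 c3 ->
  jet3 (fun z => / F z)%C 1 (- c1) (c1 * c1 - c2) (RtoC 2 * c1 * c2 - c3 - c1 * c1 * c1).
Proof.
intros HF. set (d1 := (- c1)%C). set (d2 := (c1 * c1 - c2)%C). set (d3 := (RtoC 2 * c1 * c2 - c3 - c1 * c1 * c1)%C).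
assert (J := jet3_mult _ _ _ _ _ _ _ _ _ _ HF (jet3_poly 1 d1 d2 d3)).
destruct J as (K & d & Hd & HK & H). destruct HF as (L & e & He & HL & HF).
set (B := L + Cmod c1 + Cmod c2 + Cmod c3 + 1).
assert (HB : 1 <= B) by (unfold B; generalize (Cmod_ge_0 c1) (Cmod_ge_0 c2) (Cmod_ge_0 c3); lra).
exists (2 * K), (Rmin (Rmin d e) (/ (2 * B))).
assert (HiB : 0 < / (2 * B) <= 1).
{ split; [apply Rinv_0_lt_compat; lra|]. rewrite <- Rinv_1. apply Rinv_le_contravar; lra. }
split; [repeat apply Rmin_pos; lra|]. split; [lra|]. intros z Hz.
assert (Hz1 := Rlt_le_trans _ _ _ Hz (Rmin_l _ _)). assert (Hz2 := Rlt_le_trans _ _ _ Hz (Rmin_r _ _)).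
specialize (H z ltac:(eapply Rlt_le_trans; [exact Hz1|apply Rmin_l])).
specialize (HF z ltac:(eapply Rlt_le_trans; [exact Hz1|apply Rmin_r])).
assert (Hz0 := Cmod_ge_0 z).
assert (HzB : Cmod z * B <= / 2).
{ replace (/ 2) with (/ (2 * B) * B) by (field; lra). apply Rmult_le_compat_r; lra. }
assert (Hhalf : / 2 <= Cmod (F z)).
{ assert (T := Cmod_triangle_inv 1 (1 - F z)). replace (1 - (1 - F z))%C with (F z) in T by ring. rewrite Cmod_1 in T.
  assert (Cmod (1 - F z) <= B * Cmod z).
  { replace (1 - F z)%C with (- (F z - (1 + c1 * z + c2 * (z * z) + c3 * (z * z * z))) + - (z * (c1 + c2 * z + c3 * (z * z) + 0 * (z * z * z))))%C by ring.
    eapply Rle_trans; [apply Cmod_triangle|]. rewrite !Cmod_opp, Cmod_mult.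
    assert (P := poly3_bound c1 c2 c3 0 z ltac:(lra)). rewrite Cmod_0 in P.
    assert (Cmod z ^ 4 <= Cmod z).
    { replace (Cmod z ^ 4) with (Cmod z * Cmod z ^ 3) by ring.
      assert (Cmod z ^ 3 <= 1) by (rewrite <- (pow1 3); apply pow_incr; lra). nra. }
    unfold B.
    assert (L * Cmod z ^ 4 <= L * Cmod z) by (apply Rmult_le_compat_l; lra).
    assert (Cmod z * Cmod (c1 + c2 * z + c3 * (z * z) + 0 * (z * z * z)) <= Cmod z * (Cmod c1 + Cmod c2 + Cmod c3)) by (apply Rmult_le_compat_l; lra).
    lra. }
  lra. }
assert (HFn : F z <> RtoC 0) by (intros E; rewrite E, Cmod_0 in Hhalf; lra).
replace (/ F z - (1 + d1 * z + d2 * (z * z) + d3 * (z * z * z)))%C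
  with (- / F z * (F z * (1 + d1 * z + d2 * (z * z) + d3 * (z * z * z)) -
       (1 * 1 + (1 * d1 + c1 * 1) * z + (1 * d2 + c1 * d1 + c2 * 1) * (z * z) + (1 * d3 + c1 * d2 + c2 * d1 + c3 * 1) * (z * z * z))))%C.
2:{ unfold d1, d2, d3. field. assumption. }
rewrite Cmod_mult, Cmod_opp, Cmod_inv by assumption. rewrite Rmult_assoc.
apply Rmult_le_compat; [left; apply Rinv_0_lt_compat; lra|apply Cmod_ge_0| |exact H].
replace 2 with (/ / 2) by field. apply Rinv_le_contravar; lra.
Qed.

(** After four shifts the tail is at most [Cmod z ^ 4] times a convergent series taken at radius
    1/2. *)
Lemma jet3_CPS a : tame a -> jet3 (CPS a) (a 0%nat) (a 1%nat) (a 2%nat) (a 3%nat).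
Proof.
intros Ha.
assert (Hex := tame_ex_series a (1 / 2) Ha ltac:(lra)).
assert (Hex4 : ex_series (fun n => Cmod (a (S (S (S (S n))))) * (1 / 2) ^ n)).
{ do 4 apply (proj1 (ex_series_incr_1 (K:=R_AbsRing) (V:=R_NormedModule) _)) in Hex. cbv beta in Hex.
  apply ex_series_ext with (fun n => 16 * (Cmod (a (S (S (S (S n))))) * (1 / 2) ^ (S (S (S (S n)))))).
  - intros n. simpl. field.
  - apply (ex_series_scal_l (K:=R_AbsRing) (V:=R_NormedModule)). exact Hex. }
exists (Rabs (Series (fun n => Cmod (a (S (S (S (S n))))) * (1 / 2) ^ n))), (1 / 2).
split; [lra|]. split; [apply Rabs_pos|]. intros z Hz.
assert (S0 := CPS_correct a z Ha ltac:(unfold unit_disk; lra)).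
do 4 apply cseries_shift in S0. cbv beta in S0.
replace (CPS a z - _)%C with (CPS a z - a 0%nat * z ^ 0 - a 1%nat * z ^ 1 - a 2%nat * z ^ 2 - a 3%nat * z ^ 3)%C by (simpl; ring).
eapply Rle_trans.
- apply (cseries_bound _ _ (fun n => Cmod z ^ 4 * (Cmod (a (S (S (S (S n))))) * (1 / 2) ^ n)) S0).
  + intros n. rewrite Cmod_mult, Cmod_pow.
    replace (Cmod z ^ S (S (S (S n)))) with (Cmod z ^ 4 * Cmod z ^ n) by (simpl; ring).
    assert (Cmod z ^ n <= (1 / 2) ^ n) by (apply pow_incr; split; [apply Cmod_ge_0|lra]).
    assert (0 <= Cmod z ^ 4) by (apply pow_le, Cmod_ge_0).
    assert (0 <= Cmod (a (S (S (S (S n)))))) by apply Cmod_ge_0.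
    replace (Cmod (a (S (S (S (S n))))) * (Cmod z ^ 4 * Cmod z ^ n)) with (Cmod z ^ 4 * (Cmod (a (S (S (S (S n))))) * Cmod z ^ n)) by ring.
    repeat apply Rmult_le_compat_l; assumption.
  + apply (ex_series_scal_l (K:=R_AbsRing) (V:=R_NormedModule)). exact Hex4.
- rewrite Series_scal_l, Rmult_comm. apply Rmult_le_compat_r; [apply pow_le, Cmod_ge_0|apply Rle_abs].
Qed.

(** * Jets of the exponential and the sine *)

Definition exp_coef (n : nat) : C := RtoC (/ INR (fact n)).

Lemma tame_bounded a : (forall n, Cmod (a n) <= 1) -> tame a.
Proof.
intros H r Hr. exists 1. intros n. assert (0 <= r ^ n <= 1).
{ split; [apply pow_le; lra|]. rewrite <- (pow1 n). apply pow_incr. lra. }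
assert (H1 := H n). assert (H2 := Cmod_ge_0 (a n)). nra.
Qed.

Lemma tame_exp_coef : tame exp_coef.
Proof.
apply tame_bounded. intros n. unfold exp_coef.
assert (H := lt_O_fact n). apply lt_INR in H as H0. simpl in H0. apply le_INR in H. simpl in H.
rewrite Cmod_R, Rabs_pos_eq by (left; now apply Rinv_0_lt_compat). rewrite <- Rinv_1. apply Rinv_le_contravar; lra.
Qed.

Lemma CPS_ext a b z : (forall n, a n = b n) -> CPS a z = CPS b z.
Proof.
intros H. unfold CPS, CSeries. f_equal; apply Series_ext; intros n; now rewrite H.
Qed.

(** The series is its own derivative, so its product with [Cexp (- z)] is constant. The disk is
    enough, as jets are local. *)
Lemma CPS_exp_coef z : unit_disk z -> CPS exp_coef z = Cexp z.
Proof.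
intros Hz.
assert (H : forall w, unit_disk w -> (CPS exp_coef w * Cexp (- w))%C = RtoC 1).
{ intros w Hw.
  rewrite (disk_const (fun w => CPS exp_coef w * Cexp (- w))%C (fun _ => RtoC 0)); [| |reflexivity|assumption].
  - rewrite CPS_0. replace (- RtoC 0)%C with (RtoC 0) by ring. rewrite Cexp_0. unfold exp_coef. simpl. rewrite Rinv_1. ring.
  - intros v Hv. eapply cder_eq.
    + apply cder_mult; [apply cder_CPS; [apply tame_exp_coef|assumption]|].
      apply (cder_comp Cexp Copp); [apply cder_Cexp|apply cder_opp, cder_id].
    + rewrite (CPS_ext (derived exp_coef) exp_coef). { ring. }
      intros n. unfold derived, exp_coef. rewrite <- RtoC_mult. f_equal.
      rewrite fact_simpl, mult_INR. field. split; [apply INR_fact_neq_0|apply not_0_INR; lia]. }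
assert (H1 := H z Hz). assert (H2 := Cexp_opp_mult z).
transitivity (CPS exp_coef z * Cexp (- z) * Cexp z)%C.
- transitivity (CPS exp_coef z * (Cexp z * Cexp (- z)))%C; [rewrite H2|]; ring.
- rewrite H1. ring.
Qed.

(** The jet calculus handles [1 + V + V^2/2 + V^3/6]. Since [V(0) = 0] gives [|V(z)| <= B |z|], the
    tail of the exponential at [V(z)] is also of order [|z|^4]. *)
Lemma jet3_Cexp V v1 v2 v3 : jet3 V 0 v1 v2 v3 ->
  jet3 (fun z => Cexp (V z)) 1 v1 (v2 + RtoC (1/2) * (v1 * v1)) (v3 + v1 * v2 + RtoC (1/6) * (v1 * v1 * v1)).
Proof.
intros HV.
assert (HV2 := jet3_mult _ _ _ _ _ _ _ _ _ _ HV HV).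
assert (HV3 := jet3_mult _ _ _ _ _ _ _ _ _ _ HV2 HV).
assert (J := jet3_plus _ _ _ _ _ _ _ _ _ _ (jet3_plus _ _ _ _ _ _ _ _ _ _ (jet3_plus _ _ _ _ _ _ _ _ _ _ (jet3_poly 1 0 0 0) HV)
  (jet3_scal (RtoC (1/2)) _ _ _ _ _ HV2)) (jet3_scal (RtoC (1/6)) _ _ _ _ _ HV3)).
destruct J as (K & d & Hd & HK & H).
destruct (jet3_CPS _ tame_exp_coef) as (L & e & He & HL & HE).
destruct HV as (M & g & Hg & HM & HV).
set (B := M + Cmod v1 + Cmod v2 + Cmod v3 + 1).
assert (HB : 1 <= B) by (unfold B; generalize (Cmod_ge_0 v1) (Cmod_ge_0 v2) (Cmod_ge_0 v3); lra).
assert (He1 : 0 < Rmin e 1) by (apply Rmin_pos; lra).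
assert (Hq : 0 < Rmin e 1 / B) by (apply Rdiv_lt_0_compat; lra).
exists (K + L * B ^ 4), (Rmin (Rmin d g) (Rmin 1 (Rmin e 1 / B))).
split; [repeat apply Rmin_pos; lra|].
assert (HB4 : 0 <= B ^ 4) by (apply pow_le; lra). assert (0 <= L * B ^ 4) by (apply Rmult_le_pos; assumption).
split; [lra|]. intros z Hz.
assert (Hz1 := Rlt_le_trans _ _ _ Hz (Rmin_l _ _)). assert (Hz2 := Rlt_le_trans _ _ _ Hz (Rmin_r _ _)).
assert (Hz3 := Rlt_le_trans _ _ _ Hz2 (Rmin_l _ _)). assert (Hz4 := Rlt_le_trans _ _ _ Hz2 (Rmin_r _ _)).
specialize (H z ltac:(eapply Rlt_le_trans; [exact Hz1|apply Rmin_l])).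
specialize (HV z ltac:(eapply Rlt_le_trans; [exact Hz1|apply Rmin_r])).
assert (Hz0 := Cmod_ge_0 z).
assert (HVz : Cmod (V z) <= B * Cmod z).
{ replace (V z) with ((V z - (0 + v1 * z + v2 * (z * z) + v3 * (z * z * z))) + z * (v1 + v2 * z + v3 * (z * z) + 0 * (z * z * z)))%C by ring.
  eapply Rle_trans; [apply Cmod_triangle|]. rewrite Cmod_mult.
  assert (P := poly3_bound v1 v2 v3 0 z ltac:(lra)). rewrite Cmod_0 in P.
  assert (Cmod z ^ 4 <= Cmod z).
  { replace (Cmod z ^ 4) with (Cmod z * Cmod z ^ 3) by ring.
    assert (Cmod z ^ 3 <= 1) by (rewrite <- (pow1 3); apply pow_incr; lra). nra. }
  unfold B.
  assert (M * Cmod z ^ 4 <= M * Cmod z) by (apply Rmult_le_compat_l; lra).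
  assert (Cmod z * Cmod (v1 + v2 * z + v3 * (z * z) + 0 * (z * z * z)) <= Cmod z * (Cmod v1 + Cmod v2 + Cmod v3)) by (apply Rmult_le_compat_l; lra).
  lra. }
assert (HBz : B * Cmod z < Rmin e 1) by (rewrite Rmult_comm; apply <- Rlt_div_r; lra).
assert (Hme := Rmin_l e 1). assert (Hm1 := Rmin_r e 1).
specialize (HE (V z) ltac:(lra)). rewrite CPS_exp_coef in HE by (unfold unit_disk; lra).
assert (HV4 : Cmod (V z) ^ 4 <= B ^ 4 * Cmod z ^ 4).
{ rewrite <- Rpow_mult_distr. apply pow_incr. split; [apply Cmod_ge_0|assumption]. }
assert (HE' : L * Cmod (V z) ^ 4 <= L * (B ^ 4 * Cmod z ^ 4)) by (apply Rmult_le_compat_l; assumption).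
match type of HE with Cmod ?x <= _ => match type of H with Cmod ?y <= _ =>
  replace (Cexp (V z) - _)%C with (x + y)%C end end.
- eapply Rle_trans; [apply Cmod_triangle|]. lra.
- unfold exp_coef.
  replace (/ INR (fact 0)) with 1 by (simpl; field). replace (/ INR (fact 1)) with 1 by (simpl; field).
  replace (/ INR (fact 2)) with (1/2) by (simpl; field). replace (/ INR (fact 3)) with (1/6) by (simpl; field).
  replace (RtoC (1/2)) with (/ RtoC 2)%C by (rewrite RtoC_div; [field|lra]).
  field.
Qed.

Lemma RtoC_neq (x y : R) : x <> y -> RtoC x <> RtoC y.
Proof. intros H E. now apply H, RtoC_inj. Qed.

Lemma Ci_sqr : (Ci * Ci = - (1))%C.
Proof. unfold Ci, Cmult, Copp, RtoC; simpl. f_equal; ring. Qed.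

Lemma jet3_Csin V v1 v2 v3 : jet3 V 0 v1 v2 v3 ->
  jet3 (fun z => Csin (V z)) 0 v1 v2 (v3 - RtoC (1/6) * (v1 * v1 * v1)).
Proof.
intros HV.
assert (Jp := jet3_Cexp _ _ _ _ (jet3_eq _ _ _ _ _ _ _ _ _ (jet3_scal Ci _ _ _ _ _ HV) (Cmult_0_r Ci) eq_refl eq_refl eq_refl)).
assert (Jm := jet3_Cexp _ _ _ _ (jet3_eq _ _ _ _ _ _ _ _ _ (jet3_scal (- Ci) _ _ _ _ _ HV) (Cmult_0_r (- Ci)) eq_refl eq_refl eq_refl)).
assert (J := jet3_scal (/ (RtoC 2 * Ci)) _ _ _ _ _ (jet3_plus _ _ _ _ _ _ _ _ _ _ Jp (jet3_scal (- (1)) _ _ _ _ _ Jm))).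

apply jet3_ext with (r := 1) (G := fun z => Csin (V z)) in J; [|lra|].
- eapply jet3_eq; [exact J| | | |].
  + field; apply Ci_nz.
  + field; apply Ci_nz.
  + field; apply Ci_nz.
  (* [field] sees [Ci] as an atom, so the minus sign is first written as [Ci * Ci]; the other
     coefficients do not involve [Ci^2 = -1]. *)
  + replace (v3 - RtoC (1/6) * (v1 * v1 * v1))%C with (v3 + RtoC (1/6) * ((Ci * Ci) * (v1 * v1 * v1)))%C by (rewrite Ci_sqr; ring).
    field; apply Ci_nz.
- intros z _. unfold Csin. replace (- Ci * V z)%C with (- (Ci * V z))%C by ring. field; apply Ci_nz.
Qed.

(** * Coefficient bounds *)

(** A Schwarz function is only known to satisfy [|w| <= 1], so the strip bound on the open disk does
    not apply to [w z] directly. The range of the argument gives this cruder bound everywhere. *)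
Lemma Re_Carcsin_bound z : Rabs (Re (Carcsin z)) <= PI.
Proof.
replace (Re (Carcsin z)) with (Carg (Ci * z + Csqrt (1 - z * z))); [apply Carg_bound|].
unfold Carcsin, Clog, Ci, Cmult at 4, Copp; simpl; ring.
Qed.

Lemma derive_Cmod_sqr_ray U U' z t : (forall w, unit_disk w -> cder U w (U' w)) -> unit_disk z -> 0 <= t <= 1 ->
  is_derive (fun s => Cmod (U (RtoC s * z)%C) * Cmod (U (RtoC s * z)%C)) t (2 * Re (Cconj (U (RtoC t * z)%C) * (U' (RtoC t * z)%C * z))).
Proof.
intros H Hz Ht.
destruct (cder_segment U 0 z t (U' (RtoC t * z)%C)) as [HR HI].
{ rewrite Cplus_0_l. now apply H, disk_seg. }
apply is_derive_ext with (fun s => Re (U (0 + RtoC s * z)%C) * Re (U (0 + RtoC s * z)%C) + Im (U (0 + RtoC s * z)%C) * Im (U (0 + RtoC s * z)%C)).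
{ intros s. rewrite Cplus_0_l, Cmod_sqr. reflexivity. }
assert (D := is_derive_plus _ _ _ _ _ (is_derive_mult _ _ _ _ _ HR HR Rmult_comm) (is_derive_mult _ _ _ _ _ HI HI Rmult_comm)).
eapply is_derive_eq; [exact D|]. cbv beta; rewrite !Cplus_0_l.
unfold plus, mult, Re, Im, Cmult, Cconj; simpl. ring.
Qed.

(* Where [z U'(z) = A(z) U(z)] with [-2 <= Re A], the function [t^4 |U(t z)|^2] is nondecreasing. *)
Lemma ode_nonzero U U' A : (forall z, unit_disk z -> cder U z (U' z)) -> U (RtoC 0) <> RtoC 0 ->
  (forall z, unit_disk z -> U z <> RtoC 0 -> (z * U' z)%C = (A z * U z)%C) ->
  (forall z, unit_disk z -> - 2 <= Re (A z)) -> forall z, unit_disk z -> U z <> RtoC 0.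
Proof.
intros HU H0 Hode HA z Hz Hz0.
set (q := fun s => Cmod (U (RtoC s * z)%C) * Cmod (U (RtoC s * z)%C)).
set (dq := fun t => 2 * Re (Cconj (U (RtoC t * z)%C) * (U' (RtoC t * z)%C * z))).
assert (Hq : forall t, 0 <= t <= 1 -> is_derive q t (dq t)) by (intros t Ht; now apply derive_Cmod_sqr_ray).
assert (Hpos : forall t, 0 <= q t) by (intros t; unfold q; apply Rmult_le_pos; apply Cmod_ge_0).
assert (Hineq : forall t, 0 <= t <= 1 -> 0 <= t * dq t + 4 * q t).
{ intros t Ht. unfold dq, q. set (w := (RtoC t * z)%C).
  assert (Hw : unit_disk w) by now apply disk_seg.
  replace (t * (2 * Re (Cconj (U w) * (U' w * z)))) with (2 * Re (Cconj (U w) * (w * U' w))).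
  2:{ unfold w. rewrite <- !Rmult_assoc, (Rmult_comm t 2), Rmult_assoc, <- (Re_scal t). do 2 f_equal. ring. }
  destruct (Ceq_dec (U w) (RtoC 0)) as [E | E].
  - rewrite E, Cmod_0. unfold Re, Cconj, Cmult; simpl. lra.
  - rewrite Hode by assumption. replace (Cconj (U w) * (A w * U w))%C with (U w * Cconj (U w) * A w)%C by ring.
    rewrite Cconj_mult_self, Re_scal. specialize (HA w Hw). assert (Hc := Cmod_ge_0 (U w)). nra. }
(* The monotone quantity [t^4 q(t)] is 0 at [t = 0], so the comparison starts at a small [t0 > 0]
   where [U] is still nonzero by continuity. *)
destruct (cder_cont U 0 _ (HU _ ltac:(unfold unit_disk; rewrite Cmod_0; lra)) (Cmod (U 0))) as (d & Hd & Hc).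
{ now apply Cmod_gt_0. }
assert (Hm := Rmin_l (d / 2) (1 / 2)). assert (Hm' := Rmin_r (d / 2) (1 / 2)).
set (t0 := Rmin (d / 2) (1 / 2)) in *. assert (Ht0 : 0 < t0) by (apply Rmin_pos; lra).
assert (Hn0 : 0 < q t0).
{ assert (0 < Cmod (U (RtoC t0 * z)%C)); [|unfold q; nra]. apply Cmod_gt_0. intros E.
  specialize (Hc (RtoC t0 * z)%C). rewrite E in Hc.
  replace (RtoC t0 * z - 0)%C with (RtoC t0 * z)%C in Hc by ring.
  replace (0 - U 0)%C with (- U 0)%C in Hc by ring. rewrite Cmod_opp, Cmod_mult, Cmod_R, Rabs_pos_eq in Hc by lra.
  unfold unit_disk in Hz. assert (Hz' := Cmod_ge_0 z). assert (t0 * Cmod z < d) by nra. specialize (Hc H). lra. }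
assert (Hd' : forall t, 0 <= t <= 1 -> is_derive (fun s => s ^ 4 * q s) t (t ^ 3 * (t * dq t + 4 * q t))).
{ intros t Ht. assert (D4 : is_derive (fun s => s ^ 4) t (4 * t ^ 3)) by (auto_derive; [trivial|simpl; ring]).
  assert (D := is_derive_mult _ _ _ _ _ D4 (Hq t Ht) Rmult_comm).
  eapply is_derive_eq; [exact D|]. unfold plus, mult; simpl. ring. }
destruct (MVT_gen (fun s => s ^ 4 * q s) t0 1 (fun t => t ^ 3 * (t * dq t + 4 * q t))) as (c & Hcc & E);
  try (rewrite Rmin_left, Rmax_right by lra).
- intros t Ht. apply Hd'. lra.
- intros t Ht. eapply is_derive_continuity_pt, Hd'. lra.
- rewrite Rmin_left, Rmax_right in Hcc by lra.
  assert (E1 : q 1 = 0) by (unfold q; rewrite Cmult_1_l, Hz0, Cmod_0; ring). rewrite E1 in E.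
  assert (0 <= c ^ 3 * (c * dq c + 4 * q c) * (1 - t0)).
  { apply Rmult_le_pos; [|lra]. apply Rmult_le_pos; [apply pow_le; lra|apply Hineq; lra]. }
  assert (0 < t0 ^ 4 * q t0) by (apply Rmult_lt_0_compat; [apply pow_lt|]; assumption). lra.
Qed.

Lemma smooth_Csin n U F : smooth n U F -> smooth n U (fun z => Csin (F z)).
Proof.
intros H. unfold Csin, Cdiv. apply smooth_mult; [|apply smooth_const].
apply smooth_minus; apply smooth_Cexp; [|apply smooth_opp]; (apply smooth_mult; [apply smooth_const|assumption]).
Qed.

Lemma expansion_CPS f a : normalized_expansion f a ->
  tame a /\ (forall z, unit_disk z -> f z = CPS a z).
Proof.
intros (_ & _ & H).
assert (H' : forall z, unit_disk z -> cseries (fun n => a n * z ^ n)%C (f z)) by (intros z Hz; now apply is_pseries_cseries, H).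
split.
- apply cseries_tame. intros z Hz. eexists. now apply H'.
- intros z Hz. symmetry. now apply CPS_unique, H'.
Qed.

Lemma C_derive_CPS f a z : tame a -> (forall w, unit_disk w -> f w = CPS a w) -> unit_disk z ->
  C_derive f z = CPS (derived a) z.
Proof.
intros Ha Hf Hz. apply is_C_derive_unique, cder_iff. destruct (unit_disk_open z Hz) as (r & Hr & Hw).
apply cder_ext with (CPS a) r; [assumption| |now apply cder_CPS].
intros w Hww. symmetry. auto.
Qed.

Lemma C_derive2_CPS f a z : tame a -> (forall w, unit_disk w -> f w = CPS a w) -> unit_disk z ->
  C_derive (C_derive f) z = CPS (derived (derived a)) z.
Proof.
intros Ha Hf Hz. apply C_derive_CPS; [now apply tame_derived| |assumption]. intros w Hw. now apply C_derive_CPS.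
Qed.

Lemma class_C_arcsin_coefs f a : class_C_arcsin f -> normalized_expansion f a ->
  exists w c1 c2 c3, bounded_jet w c1 c2 c3 /\
    c1 = (RtoC PI * a 2%nat)%C /\ c2 = (RtoC PI * (RtoC 3 * a 3%nat - RtoC 2 * (a 2%nat * a 2%nat)))%C /\
    c3 = (RtoC PI * (RtoC 6 * a 4%nat - RtoC 9 * (a 2%nat * a 3%nat) + RtoC 4 * (a 2%nat * a 2%nat * a 2%nat)) - RtoC (1/6) * (c1 * c1 * c1))%C.
Proof.
intros [_ (w & (_ & _ & Hw1) & Hsub)] Hexp.
destruct (expansion_CPS f a Hexp) as [Ha Hf]. destruct Hexp as (_ & Ha1 & _).
assert (HPI := PI_RGT_0).
assert (HPIn : RtoC PI <> RtoC 0) by (apply RtoC_neq; lra).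
set (U := CPS (derived a)). set (U' := CPS (derived (derived a))).
assert (Ha' := tame_derived a Ha). assert (Ha'' := tame_derived _ Ha').
assert (HU : forall z, unit_disk z -> cder U z (U' z)) by (intros z Hz; now apply cder_CPS).
assert (Hsub' : forall z, unit_disk z -> (z * U' z / U z)%C = (RtoC (2 / PI) * Carcsin (w z))%C).
{ intros z Hz. specialize (Hsub z Hz). cbv beta in Hsub.
  rewrite (C_derive_CPS f a z Ha Hf Hz), (C_derive2_CPS f a z Ha Hf Hz) in Hsub. fold U U' in Hsub.
  replace (z * U' z / U z)%C with (1 + z * U' z / U z - 1)%C by ring. rewrite Hsub. ring. }
assert (HU0 : U 0 = RtoC 1).
{ unfold U. rewrite CPS_0. unfold derived. rewrite Ha1. simpl. ring. }
assert (Hn : forall z, unit_disk z -> U z <> RtoC 0).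
{ apply (ode_nonzero U U' (fun z => RtoC (2 / PI) * Carcsin (w z))%C HU).
  - rewrite HU0. apply C1_nz.
  - intros z Hz Hzn. rewrite <- Hsub' by assumption. field. assumption.
  - intros z _. rewrite Re_scal. assert (H := Re_Carcsin_bound (w z)). apply Rabs_le_between in H.
    replace (-2) with (2 / PI * - PI) by (field; lra). apply Rmult_le_compat_l; [|lra].
    left. apply Rdiv_lt_0_compat; lra. }
set (V := fun z => (RtoC (PI / 2) * (z * U' z * / U z))%C).
assert (HwV : forall z, unit_disk z -> Csin (V z) = w z).
{ intros z Hz. rewrite <- (Carcsin_spec (w z)). f_equal. unfold V.
  change (z * U' z * / U z)%C with (z * U' z / U z)%C. rewrite Hsub' by assumption.
  rewrite Cmult_assoc, <- RtoC_mult. replace (PI / 2 * (2 / PI)) with 1 by (field; lra). ring. }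
assert (HVs : smooth 2 unit_disk V).
{ unfold V. apply smooth_mult; [apply smooth_const|]. apply smooth_mult.
  - apply smooth_mult; [apply smooth_id|now apply smooth_CPS].
  - apply smooth_inv; [assumption|now apply smooth_CPS]. }
assert (JU := jet3_CPS _ Ha'). assert (JU' := jet3_CPS _ Ha'').
unfold derived in JU at 2. rewrite Ha1 in JU.
(* The normalization [a 1 = 1] gives [f'] the constant term 1 that the jet of the inverse expects;
   below, the factor [z] gives [V] the constant term 0 that the jet of the sine expects. *)
eapply jet3_eq in JU; [|simpl; apply Cmult_1_r|reflexivity..].
assert (Jz : jet3 (fun z => z) 0 1 0 0).
{ eapply jet3_ext; [exact Rlt_0_1| |apply (jet3_poly 0 1 0 0)]. intros z _. cbv beta. ring. }
assert (JV := jet3_scal (RtoC (PI / 2)) _ _ _ _ _ (jet3_mult _ _ _ _ _ _ _ _ _ _ (jet3_mult _ _ _ _ _ _ _ _ _ _ Jz JU') (jet3_inv _ _ _ _ JU))).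
eapply jet3_eq in JV; [|now ring_simplify|reflexivity..].
assert (Jw := jet3_Csin _ _ _ _ JV).
apply jet3_ext with (r := 1) (G := w) in Jw; [|lra|exact HwV].
eexists w, _, _, _. split; [split; [|split; [exact Hw1|exact Jw]]|].
- apply smooth_ext with (fun z => Csin (V z)); [apply unit_disk_open|exact HwV|]. now apply smooth_Csin.
- unfold derived. simpl INR.
  replace (RtoC PI) with (RtoC 2 * RtoC (PI / 2))%C by (rewrite <- RtoC_mult; f_equal; field).
  rewrite ?RtoC_plus.
  split; [ring|split]; ring.
Qed.

Lemma Cmod_real_scal_le (x : R) z : 0 <= x -> Cmod z <= 1 -> Cmod (RtoC x * z) <= x.
Proof. intros Hx Hz. rewrite Cmod_mult, Cmod_R, Rabs_pos_eq by assumption. nra. Qed.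

Lemma coefficient_bounds f a : class_C_arcsin f -> normalized_expansion f a ->
  Cmod (a 2%nat) <= 1 / PI /\ Cmod (a 3%nat) <= 1 / (3 * PI) /\ Cmod (a 4%nat) <= 1 / (6 * PI).
Proof.
intros Hf Ha. destruct (class_C_arcsin_coefs f a Hf Ha) as (w & c1 & c2 & c3 & Hw & E1 & E2 & E3).
assert (HPI3 : 3 < PI) by (generalize PI2_3_2; lra). assert (HPI4 := PI_4).
assert (HPIn : RtoC PI <> RtoC 0) by (apply RtoC_neq; lra).
assert (Hi : 0 < / PI < / 3) by (split; [apply Rinv_0_lt_compat; lra|apply Rinv_lt_contravar; lra]).
split; [|split].
- replace (a 2%nat) with (RtoC (1 / PI) * c1)%C.
  + apply Cmod_real_scal_le; [unfold Rdiv; lra|]. eapply schwarz_coef1; exact Hw.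
  + rewrite E1, RtoC_div by lra. field. assumption.
- replace (a 3%nat) with (RtoC (1 / (3 * PI)) * (c2 + RtoC (2 / PI) * (c1 * c1)))%C.
  + apply Cmod_real_scal_le; [left; apply Rdiv_lt_0_compat; lra|]. eapply schwarz_coef2; [exact Hw|unfold Rdiv; lra].
  + rewrite E2, E1, !RtoC_div, RtoC_mult by lra. field. repeat split; try assumption; apply RtoC_neq; lra.
(* Obtained by solving the triangular system for [a 2], [a 3], [a 4] in turn. *)
- replace (a 4%nat) with (RtoC (1 / (6 * PI)) * (c3 + RtoC (3 / PI) * (c1 * c2) + RtoC (1 / 6 + 2 / PI ^ 2) * (c1 * c1 * c1)))%C.
  + apply Cmod_real_scal_le; [left; apply Rdiv_lt_0_compat; lra|]. eapply schwarz_coef3; [exact Hw|].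
    replace ((3 / PI) ^ 2 / 4) with (9 / 4 * (/ PI * / PI)) by (field; lra).
    replace (1 / 6 + 2 / PI ^ 2 - 9 / 4 * (/ PI * / PI)) with (1 / 6 - 1 / 4 * (/ PI * / PI)) by (field; lra).
    (* Here [nu - mu^2/4 = 1/6 - 1/(4 PI^2)] is positive, so the condition reads
       [1/6 + 2/PI^2 <= 1], for which [PI > 3] suffices. *)
    assert (0 < / PI * / PI < / 9) by (split; nra). rewrite Rabs_pos_eq; lra.
  + rewrite E3, E2, E1. rewrite !RtoC_plus, !RtoC_div, RtoC_mult, RtoC_pow by (try apply pow_nonzero; lra).
    field. repeat split; try assumption; apply RtoC_neq; lra.
Qed.

(** * Power series of arcsin *)

Definition complexify (g : nat -> R) (n : nat) : C := RtoC (g n).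

Lemma tame_complexify g : (forall n, 0 <= g n <= 1) -> tame (complexify g).
Proof.
intros H. apply tame_bounded. intros n. unfold complexify. rewrite Cmod_R, Rabs_pos_eq; apply H.
Qed.

(** The Euler operator [z d/dz] multiplies the coefficient of index [n] by [n]; it turns
    differential equations into coefficient identities without an index shift. *)
Lemma cseries_euler a z : tame a -> unit_disk z ->
  cseries (fun n => RtoC (INR n) * a n * z ^ n)%C (z * CPS (derived a) z)%C.
Proof.
intros Ha Hz. apply cseries_unshift. simpl (INR 0).
replace (z * CPS (derived a) z - 0 * a 0%nat * z ^ 0)%C with (z * CPS (derived a) z)%C by ring.
eapply cseries_ext; [|apply cseries_scal, CPS_correct; [now apply tame_derived|exact Hz]].
intros n. unfold derived. cbv beta. simpl Cpow. ring.
Qed.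

(* Taylor coefficients of [1 / sqrt (1 - z^2)]. *)
Fixpoint arcsin_deriv_coef (n : nat) : R :=
  match n with
  | O => 1
  | S O => 0
  | S (S m) => INR (S m) / INR (S (S m)) * arcsin_deriv_coef m
  end.

Definition arcsin_coef (n : nat) : R :=
  match n with O => 0 | S m => arcsin_deriv_coef m / INR (S m) end.

Lemma INR_S_pos n : 0 < INR (S n).
Proof. apply lt_0_INR. lia. Qed.

Lemma INR_S_ge1 n : 1 <= INR (S n).
Proof. rewrite S_INR. generalize (pos_INR n). lra. Qed.

Lemma arcsin_deriv_coef_bound n : 0 <= arcsin_deriv_coef n <= 1.
Proof.
assert (H : (0 <= arcsin_deriv_coef n <= 1) /\ (0 <= arcsin_deriv_coef (S n) <= 1)).
{ induction n as [|n [IH1 IH2]]; [simpl; lra|]. split; [exact IH2|].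
  change (arcsin_deriv_coef (S (S n))) with (INR (S n) / INR (S (S n)) * arcsin_deriv_coef n).
  assert (P := INR_S_pos n). assert (Q := INR_S_pos (S n)).
  assert (0 <= INR (S n) / INR (S (S n)) <= 1).
  { split; [apply Rdiv_le_0_compat; lra|]. apply <- Rle_div_l; [|assumption]. rewrite (S_INR (S n)). lra. }
  nra. }
apply H.
Qed.

Lemma arcsin_coef_bound n : 0 <= arcsin_coef n <= 1.
Proof.
destruct n as [|n]; [simpl; lra|]. change (arcsin_coef (S n)) with (arcsin_deriv_coef n / INR (S n)). assert (P := INR_S_ge1 n). assert (B := arcsin_deriv_coef_bound n).
split; [apply Rdiv_le_0_compat; lra|]. apply <- Rle_div_l; [|lra]. lra.
Qed.

Definition arcsin_deriv := CPS (complexify arcsin_deriv_coef).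
Definition arcsin_series := CPS (complexify arcsin_coef).

Lemma tame_arcsin_deriv : tame (complexify arcsin_deriv_coef).
Proof. apply tame_complexify, arcsin_deriv_coef_bound. Qed.

Lemma tame_arcsin : tame (complexify arcsin_coef).
Proof. apply tame_complexify, arcsin_coef_bound. Qed.

Lemma cder_arcsin_series z : unit_disk z -> cder arcsin_series z (arcsin_deriv z).
Proof.
intros Hz. eapply cder_eq; [apply cder_CPS; [apply tame_arcsin|assumption]|].
apply CPS_ext. intros n. unfold derived, complexify. rewrite <- RtoC_mult. f_equal.
change (arcsin_coef (S n)) with (arcsin_deriv_coef n / INR (S n)). field. apply not_0_INR. lia.
Qed.

Definition arcsin_deriv2 := CPS (derived (complexify arcsin_deriv_coef)).

(** The recursion [(n+2) d_(n+2) = (n+1) d_n] with [d_1 = 0] says [D' = z (z D' + D)], which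
    rearranges to the claim. *)
Lemma arcsin_deriv_ode z : unit_disk z -> (arcsin_deriv2 z * (1 - z * z))%C = (z * arcsin_deriv z)%C.
Proof.
intros Hz.
assert (E : arcsin_deriv2 z = (z * (z * arcsin_deriv2 z + arcsin_deriv z))%C).
{ assert (S1 := cseries_shift _ _ (CPS_correct _ z (tame_derived _ tame_arcsin_deriv) Hz)). cbv beta in S1.
  assert (S2 := cseries_scal z _ _ (cseries_plus _ _ _ _ (cseries_euler _ z tame_arcsin_deriv Hz) (CPS_correct _ z tame_arcsin_deriv Hz))).
  cbv beta in S2. apply cseries_unique in S2. fold arcsin_deriv2 in S1.
  etransitivity; [|exact S2]. symmetry.
  replace (arcsin_deriv2 z - derived (complexify arcsin_deriv_coef) 0 * z ^ 0)%C with (arcsin_deriv2 z) in S1.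
  2:{ unfold derived, complexify. simpl. ring. }
  apply cseries_unique. eapply cseries_ext; [|exact S1]. intros n. cbv beta. unfold derived, complexify.
  replace (RtoC (INR (S (S n))) * RtoC (arcsin_deriv_coef (S (S n))))%C with (RtoC (INR (S n) * arcsin_deriv_coef n)).
  2:{ rewrite <- RtoC_mult. f_equal. change (arcsin_deriv_coef (S (S n))) with (INR (S n) / INR (S (S n)) * arcsin_deriv_coef n).
      field. apply not_0_INR. lia. }
  rewrite S_INR, RtoC_mult, RtoC_plus. simpl Cpow. ring. }
transitivity (arcsin_deriv2 z - z * (z * arcsin_deriv2 z))%C; [ring|]. rewrite E at 1. ring.
Qed.

Lemma cder_arcsin_deriv z : unit_disk z -> cder arcsin_deriv z (arcsin_deriv2 z).
Proof. intros Hz. apply cder_CPS; [apply tame_arcsin_deriv|assumption]. Qed.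

Lemma arcsin_deriv_0 : arcsin_deriv 0 = RtoC 1.
Proof. unfold arcsin_deriv. rewrite CPS_0. reflexivity. Qed.

Lemma arcsin_series_0 : arcsin_series 0 = RtoC 0.
Proof. unfold arcsin_series. rewrite CPS_0. reflexivity. Qed.

Lemma cder_1_minus_sqr z : cder (fun w => 1 - w * w)%C z (- (RtoC 2 * z))%C.
Proof.
eapply cder_eq; [apply (cder_minus (fun _ => RtoC 1)); [apply cder_const|apply (cder_mult (fun w => w) (fun w => w)); apply cder_id]|]. ring.
Qed.

Lemma arcsin_deriv_sqr z : unit_disk z -> (arcsin_deriv z * arcsin_deriv z * (1 - z * z))%C = RtoC 1.
Proof.
intros Hz.
rewrite (disk_const (fun z => arcsin_deriv z * arcsin_deriv z * (1 - z * z))%C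
  (fun z => (arcsin_deriv2 z * arcsin_deriv z + arcsin_deriv z * arcsin_deriv2 z) * (1 - z * z) + arcsin_deriv z * arcsin_deriv z * - (RtoC 2 * z))%C); [| | |assumption].
- rewrite arcsin_deriv_0. ring.
- intros w Hw. apply (cder_mult (fun w => arcsin_deriv w * arcsin_deriv w)%C (fun w => 1 - w * w)%C); [|apply cder_1_minus_sqr].
  apply (cder_mult arcsin_deriv arcsin_deriv); now apply cder_arcsin_deriv.
- intros w Hw _. transitivity (RtoC 2 * arcsin_deriv w * (arcsin_deriv2 w * (1 - w * w)) - RtoC 2 * w * (arcsin_deriv w * arcsin_deriv w))%C; [ring|].
  rewrite arcsin_deriv_ode by assumption. ring.
Qed.

(* [cos (arcsin z) = sqrt (1 - z^2)], written as [(1 - z^2) / sqrt (1 - z^2)]. *)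
Definition cos_arcsin z := (arcsin_deriv z * (1 - z * z))%C.

Lemma cder_cos_arcsin z : unit_disk z -> cder cos_arcsin z (- (z * arcsin_deriv z))%C.
Proof.
intros Hz. eapply cder_eq; [apply (cder_mult arcsin_deriv (fun w => 1 - w * w)%C); [now apply cder_arcsin_deriv|apply cder_1_minus_sqr]|].
rewrite arcsin_deriv_ode by assumption. ring.
Qed.

Lemma cos_arcsin_sqr z : unit_disk z -> (cos_arcsin z * cos_arcsin z)%C = (1 - z * z)%C.
Proof.
intros Hz. unfold cos_arcsin. transitivity (arcsin_deriv z * arcsin_deriv z * (1 - z * z) * (1 - z * z))%C; [ring|].
rewrite arcsin_deriv_sqr by assumption. ring.
Qed.

(** With [D = arcsin'] and [c = cos_arcsin] one has [c' = - z D] and [D c = 1]; these make the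
    derivative of [(c + i z) exp (- i arcsin z)] vanish. *)
Lemma Cexp_arcsin_series z : unit_disk z -> Cexp (Ci * arcsin_series z) = (Ci * z + cos_arcsin z)%C.
Proof.
intros Hz.
assert (H : ((cos_arcsin z + Ci * z) * Cexp (- (Ci * arcsin_series z)))%C = RtoC 1).
{ rewrite (disk_const (fun z => (cos_arcsin z + Ci * z) * Cexp (- (Ci * arcsin_series z)))%C
   (fun z => (- (z * arcsin_deriv z) + Ci * 1) * Cexp (- (Ci * arcsin_series z)) + (cos_arcsin z + Ci * z) * (Cexp (- (Ci * arcsin_series z)) * - (Ci * arcsin_deriv z)))%C); [| | |assumption].
  - rewrite arcsin_series_0. unfold cos_arcsin. rewrite arcsin_deriv_0. replace (- (Ci * 0))%C with (RtoC 0) by ring. rewrite Cexp_0. ring.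
  - intros w Hw. apply (cder_mult (fun z => cos_arcsin z + Ci * z)%C (fun z => Cexp (- (Ci * arcsin_series z)))).
    + apply (cder_plus cos_arcsin (fun z => Ci * z)%C); [now apply cder_cos_arcsin|apply cder_scal, cder_id].
    + apply (cder_comp Cexp (fun w => - (Ci * arcsin_series w))%C); [apply cder_Cexp|]. apply cder_opp, cder_scal. now apply cder_arcsin_series.
  - intros w Hw _.
    assert (E : (arcsin_deriv w * cos_arcsin w)%C = RtoC 1) by (unfold cos_arcsin; rewrite Cmult_assoc; now apply arcsin_deriv_sqr).
    transitivity (Cexp (- (Ci * arcsin_series w)) * (- (w * arcsin_deriv w) + Ci - Ci * (arcsin_deriv w * cos_arcsin w) - (Ci * Ci) * w * arcsin_deriv w))%C; [ring|].
    rewrite E, Ci_sqr. ring. }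
assert (H2 := Cexp_opp_mult (Ci * arcsin_series z)).
transitivity ((cos_arcsin z + Ci * z) * Cexp (- (Ci * arcsin_series z)) * Cexp (Ci * arcsin_series z))%C; [rewrite H; ring|].
transitivity ((cos_arcsin z + Ci * z) * (Cexp (Ci * arcsin_series z) * Cexp (- (Ci * arcsin_series z))))%C; [ring|]. rewrite H2. ring.
Qed.

(** Intermediate value theorem on the ray from 0: a real part without zeros keeps its sign. *)
Lemma Re_pos_disk F F1 : (forall z, unit_disk z -> cder F z (F1 z)) -> 0 < Re (F (RtoC 0)) ->
  (forall z, unit_disk z -> Re (F z) <> 0) -> forall z, unit_disk z -> 0 < Re (F z).
Proof.
intros HF H0 Hn z Hz.
destruct (Rlt_le_dec 0 (Re (F z))) as [H | H]; [exact H|exfalso].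
assert (Hlt : Re (F z) < 0) by (destruct H as [H | H]; [assumption|now apply Hn in H]).
destruct (IVT_interv (fun s => - Re (F (0 + RtoC s * z)%C)) 0 1) as (t & Ht & E).
- intros t Ht. apply continuity_pt_opp.
  destruct (cder_segment F 0 z t (F1 (RtoC t * z)%C)) as [D _].
  { rewrite Cplus_0_l. now apply HF, disk_seg. }
  eapply is_derive_continuity_pt, D.
- lra.
- rewrite Cplus_0_l, Cmult_0_l. lra.
- rewrite Cplus_0_l, Cmult_1_l. lra.
- apply (Hn (RtoC t * z)%C); [now apply disk_seg|]. rewrite Cplus_0_l in E. lra.
Qed.

(** If the real part vanished, the square [1 - z * z] would be a real number [<= 0], which is
    impossible for [|z| < 1]. *)
Lemma Re_cos_arcsin_pos z : unit_disk z -> 0 < Re (cos_arcsin z).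
Proof.
apply (Re_pos_disk cos_arcsin (fun z => - (z * arcsin_deriv z))%C); [exact cder_cos_arcsin| |].
- unfold cos_arcsin. rewrite arcsin_deriv_0. simpl. lra.
- intros w Hw E. assert (H := cos_arcsin_sqr w Hw). assert (Hm := Cmod_sqr w). assert (H0 := Cmod_ge_0 w).
  unfold unit_disk in Hw. destruct (cos_arcsin w) as [p q]. destruct w as [x y].
  unfold Re, Im, Cmult, Cplus, Cminus, Copp, RtoC in *; simpl in *. injection H. intros H1 H2. subst p. nra.
Qed.

Lemma Re_Csqrt z : 0 <= Re (Csqrt z).
Proof.
unfold Csqrt; simpl; apply Rmult_le_pos; [apply sqrt_pos|].
assert (Hb := Carg_bound z); apply Rabs_le_between in Hb. apply cos_ge_0; lra.
Qed.

(** Both are square roots of the same number; real parts [>= 0] and [> 0] rule out that they are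
    opposite. *)
Lemma Csqrt_cos_arcsin z : unit_disk z -> Csqrt (1 - z * z) = cos_arcsin z.
Proof.
intros Hz. assert (H1 := cos_arcsin_sqr z Hz). assert (H2 := Csqrt_sqr (1 - z * z)).
assert (H3 := Re_cos_arcsin_pos z Hz). assert (H4 := Re_Csqrt (1 - z * z)).
set (s := Csqrt _) in *. set (w := cos_arcsin z) in *.
assert (E : ((s - w) * (s + w))%C = RtoC 0).
{ transitivity (s * s - w * w)%C; [ring|]. rewrite H1, H2. ring. }
destruct (Ceq_dec (s - w) 0) as [E1 | E1].
- transitivity (s - w + w)%C; [ring|]. rewrite E1. ring.
- exfalso. destruct (Ceq_dec (s + w) 0) as [E2 | E2].
  + apply (f_equal Re) in E2. rewrite Re_plus in E2. change (Re (RtoC 0)) with 0 in E2. lra.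
  + now apply (Cmult_neq_0 _ _ E1 E2).
Qed.

Lemma Cexp_Carcsin z : Cexp (Ci * Carcsin z) = (Ci * z + Csqrt (1 - z * z))%C.
Proof.
unfold Carcsin.
replace (Ci * (- Ci * Clog (Ci * z + Csqrt (1 - z * z))))%C with (- (Ci * Ci) * Clog (Ci * z + Csqrt (1 - z * z)))%C by ring.
rewrite Ci_sqr. replace (- - (1) * Clog (Ci * z + Csqrt (1 - z * z)))%C with (Clog (Ci * z + Csqrt (1 - z * z))) by ring.
apply Cexp_Clog, arcsin_log_arg_neq_0.
Qed.

Lemma Cexp_Ci z : Cexp (Ci * z) = (exp (- Im z) * cos (Re z), exp (- Im z) * sin (Re z)).
Proof.
destruct z as [x y]. unfold Cexp, Ci, Cmult, Re, Im; simpl.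
replace (0 * x - 1 * y) with (- y) by ring. replace (0 * y + 1 * x) with x by ring. reflexivity.
Qed.

(** Both sides have the same exponential after multiplication by [Ci]. Hence
    [cos (Re (arcsin_series z))] never vanishes, and the real part, starting at 0, stays in
    [(-PI/2, PI/2)] as that of the principal branch does. In this strip the exponential determines
    the value. *)
Lemma arcsin_series_Carcsin z : unit_disk z -> arcsin_series z = Carcsin z.
Proof.
assert (E : forall w, unit_disk w -> Cexp (Ci * arcsin_series w) = Cexp (Ci * Carcsin w)).
{ intros w Hw. now rewrite Cexp_arcsin_series, Cexp_Carcsin, Csqrt_cos_arcsin. }
assert (HPI := PI_RGT_0).
assert (Hc : forall w, unit_disk w -> cos (Re (arcsin_series w)) <> 0).
{ intros w Hw Hc. specialize (E w Hw). rewrite !Cexp_Ci, Hc, Rmult_0_r in E. apply pair_equal_spec in E as [E1 _].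
  assert (Hr := Re_Carcsin w Hw). apply Rabs_lt_between in Hr.
  assert (0 < cos (Re (Carcsin w))) by (apply cos_gt_0; lra).
  assert (0 < exp (- Im (Carcsin w))) by apply exp_pos. nra. }
assert (Hp : forall w, unit_disk w -> 0 < Re (RtoC (PI / 2) + arcsin_series w)).
{ apply (Re_pos_disk (fun w => RtoC (PI / 2) + arcsin_series w)%C (fun w => 0 + arcsin_deriv w)%C).
  - intros w Hw. apply cder_plus; [apply cder_const|now apply cder_arcsin_series].
  - rewrite arcsin_series_0. simpl. lra.
  - intros w Hw E0. rewrite Re_plus in E0. change (Re (RtoC (PI / 2))) with (PI / 2) in E0. apply (Hc w Hw).
    replace (Re (arcsin_series w)) with (- (PI / 2)) by lra. rewrite cos_neg. apply cos_PI2. }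
assert (Hm : forall w, unit_disk w -> 0 < Re (RtoC (PI / 2) - arcsin_series w)).
{ apply (Re_pos_disk (fun w => RtoC (PI / 2) - arcsin_series w)%C (fun w => 0 - arcsin_deriv w)%C).
  - intros w Hw. apply cder_minus; [apply cder_const|now apply cder_arcsin_series].
  - rewrite arcsin_series_0. simpl. lra.
  - intros w Hw E0. rewrite Re_minus in E0. change (Re (RtoC (PI / 2))) with (PI / 2) in E0. apply (Hc w Hw).
    replace (Re (arcsin_series w)) with (PI / 2) by lra. apply cos_PI2. }
intros Hz. specialize (Hp z Hz). specialize (Hm z Hz). specialize (E z Hz).
rewrite Re_plus in Hp. rewrite Re_minus in Hm. change (Re (RtoC (PI / 2))) with (PI / 2) in Hp, Hm.
assert (Hr := Re_Carcsin z Hz). apply Rabs_lt_between in Hr.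
rewrite !Cexp_Ci in E. set (A := Carcsin z) in *. set (K := arcsin_series z) in *.
apply pair_equal_spec in E as [E1 E2].
assert (T1 := sin2_cos2 (Re A)). assert (T2 := sin2_cos2 (Re K)). unfold Rsqr in T1, T2.
assert (P1 := exp_pos (- Im A)). assert (P2 := exp_pos (- Im K)).
assert (EE : exp (- Im K) = exp (- Im A)).
{ assert (exp (- Im K) * exp (- Im K) = exp (- Im A) * exp (- Im A)); [|nra].
  rewrite <- (Rmult_1_r (exp (- Im K) * _)), <- T2, <- (Rmult_1_r (exp (- Im A) * _)), <- T1.
  transitivity ((exp (- Im K) * sin (Re K)) * (exp (- Im K) * sin (Re K)) + (exp (- Im K) * cos (Re K)) * (exp (- Im K) * cos (Re K))); [ring|].
  rewrite E1, E2. ring. }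
assert (EI := exp_inv _ _ EE). rewrite EE in E2. apply Rmult_eq_reg_l in E2; [|lra].
apply injective_projections.
- change (Re K = Re A). rewrite <- (asin_sin (Re K)), <- (asin_sin (Re A)) by lra. now rewrite E2.
- change (Im K = Im A). lra.
Qed.

(** * Extremal functions *)

(** Taylor coefficients of [G(z^n)] when [G] has coefficients [g]. *)
Definition gap (n : nat) (g : nat -> R) (j : nat) : R :=
  if Nat.eqb (j mod n) 0 then g (j / n)%nat else 0.

Lemma gap_bound n g : (forall j, 0 <= g j <= 1) -> forall j, 0 <= gap n g j <= 1.
Proof. intros H j. unfold gap. destruct (Nat.eqb _ _); [apply H|lra]. Qed.

Lemma div_mod_S N n : (0 < n)%nat ->
  (S N mod n = 0 /\ S N / n = S (N / n) /\ S N = n * S (N / n))%nat \/ (S N mod n <> 0 /\ S N / n = N / n)%nat.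
Proof.
intros Hn. assert (E := Nat.div_mod N n ltac:(lia)). assert (L := Nat.mod_upper_bound N n ltac:(lia)).
set (q := (N / n)%nat) in *. set (r := (N mod n)%nat) in *.
destruct (Nat.eq_dec (S r) n) as [Er | Er].
- left. assert (E' : S N = (n * S q + 0)%nat) by nia.
  rewrite <- (Nat.div_unique (S N) n (S q) 0), <- (Nat.mod_unique (S N) n (S q) 0) by (assumption || lia). lia.
- right. assert (E' : S N = (n * q + S r)%nat) by nia.
  rewrite <- (Nat.div_unique (S N) n q (S r)), <- (Nat.mod_unique (S N) n q (S r)) by (assumption || lia). lia.
Qed.

Lemma sum_n_gap n g z N : (0 < n)%nat ->
  sum_n (G := C_NormedModule) (fun j => complexify (gap n g) j * z ^ j)%C N =
  sum_n (G := C_NormedModule) (fun k => complexify g k * (z ^ n) ^ k)%C (N / n).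
Proof.
intros Hn. induction N as [|N IH].
- rewrite Nat.Div0.div_0_l. rewrite !sum_O. unfold complexify, gap. now rewrite Nat.Div0.mod_0_l, Nat.Div0.div_0_l.
- rewrite sum_Sn, IH. destruct (div_mod_S N n Hn) as [(E1 & E2 & E3) | (E1 & E2)].
  + rewrite E2, sum_Sn. f_equal. unfold complexify, gap. rewrite E1, E2, <- Cpow_mult_r, <- E3. reflexivity.
  + rewrite E2. unfold complexify, gap. apply Nat.eqb_neq in E1. rewrite E1.
    change (sum_n (G := C_NormedModule) (fun k => RtoC (g k) * (z ^ n) ^ k)%C (N / n) + RtoC 0 * z ^ S N
      = sum_n (G := C_NormedModule) (fun k => RtoC (g k) * (z ^ n) ^ k)%C (N / n))%C. ring.
Qed.

Lemma unit_disk_pow n z : (0 < n)%nat -> unit_disk z -> unit_disk (z ^ n).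
Proof.
unfold unit_disk. intros Hn Hz. rewrite Cmod_pow. destruct n as [|n]; [lia|].
assert (H0 := Cmod_ge_0 z). assert (Cmod z ^ n <= 1) by (rewrite <- (pow1 n); apply pow_incr; lra).
assert (0 <= Cmod z ^ n) by (now apply pow_le). simpl. nra.
Qed.

(** The partial sum of index [N] on the left is the one of index [N / n] on the right, and [N / n]
    tends to infinity. *)
Lemma CPS_gap n g z : (0 < n)%nat -> tame (complexify g) -> unit_disk z ->
  CPS (complexify (gap n g)) z = CPS (complexify g) (z ^ n).
Proof.
intros Hn Hg Hz. apply CPS_unique.
assert (S1 := CPS_correct _ _ Hg (unit_disk_pow n z Hn Hz)).
unfold cseries, is_series in *.
apply filterlim_ext with (fun N => sum_n (G := C_NormedModule) (fun k => complexify g k * (z ^ n) ^ k)%C (N / n)).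
{ intros N. symmetry. now apply sum_n_gap. }
apply filterlim_comp with (2 := S1) (f := fun N => (N / n)%nat).
intros P [N0 HP]. exists (N0 * n)%nat. intros N HN. apply HP. apply Nat.div_le_lower_bound; lia.
Qed.

(* [exp_table p] lists the coefficients of index [<= p]. *)
Fixpoint exp_table (k : R) (h : nat -> R) (p : nat) : nat -> R :=
  match p with
  | O => fun _ => 1
  | S p => fun i => if Nat.leb i p then exp_table k h p i
           else k / INR (S p) * sum_f_R0 (fun j => h (S j) * exp_table k h p (p - j)%nat) p
  end.

(* Coefficients of the solution of [z u' = k h u], [u(0) = 1], when [h(0) = 0]. *)
Definition exp_ode_coef (k : R) (h : nat -> R) (m : nat) : R := exp_table k h m m.

Lemma exp_table_coef k h p i : (i <= p)%nat -> exp_table k h p i = exp_ode_coef k h i.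
Proof.
induction p as [|p IH]; intros Hi.
- now replace i with 0%nat by lia.
- destruct (Nat.eq_dec i (S p)) as [-> | Hn]; [reflexivity|].
  simpl. rewrite (proj2 (Nat.leb_le i p)) by lia. apply IH. lia.
Qed.

Lemma exp_ode_coef_S k h p :
  exp_ode_coef k h (S p) = k / INR (S p) * sum_f_R0 (fun j => h (S j) * exp_ode_coef k h (p - j)%nat) p.
Proof.
unfold exp_ode_coef at 1. cbn [exp_table]. rewrite (proj2 (Nat.leb_gt (S p) p)) by lia.
f_equal. apply sum_eq. intros i Hi. rewrite exp_table_coef by lia. reflexivity.
Qed.

(** Strong induction: the recursion takes [k] times the average of [p + 1] numbers in [[0, 1]]. *)
Lemma exp_ode_coef_bound k h : 0 <= k <= 1 -> (forall j, 0 <= h j <= 1) -> forall m, 0 <= exp_ode_coef k h m <= 1.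
Proof.
intros Hk Hh m. induction m as [m IH] using lt_wf_ind. destruct m as [|p]; [unfold exp_ode_coef; simpl; lra|].
rewrite exp_ode_coef_S.
assert (HS : 0 <= sum_f_R0 (fun j => h (S j) * exp_ode_coef k h (p - j)%nat) p <= INR (S p)).
{ assert (Ht : forall j, (j <= p)%nat -> 0 <= h (S j) * exp_ode_coef k h (p - j)%nat <= 1).
  { intros j Hj. specialize (Hh (S j)). specialize (IH (p - j)%nat ltac:(lia)). nra. }
  split.
  - apply Rle_trans with (sum_f_R0 (fun _ => 0) p); [rewrite sum_cte; lra|]. apply sum_Rle. intros j Hj. apply Ht. exact Hj.
  - apply Rle_trans with (sum_f_R0 (fun _ => 1) p); [|rewrite sum_cte; lra]. apply sum_Rle. intros j Hj. apply Ht. exact Hj. }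
assert (P := INR_S_pos p). set (s := sum_f_R0 _ _) in *.
replace (k / INR (S p) * s) with (k * (s / INR (S p))) by (field; lra).
assert (0 <= s / INR (S p) <= 1).
{ split; [apply Rdiv_le_0_compat; lra|]. apply <- Rle_div_l; lra. }
nra.
Qed.

Lemma sum_n_RtoC (g : nat -> R) n : sum_n (G := C_NormedModule) (fun k => RtoC (g k)) n = RtoC (sum_f_R0 g n).
Proof.
rewrite sum_n_Re_Im. unfold RtoC at 3. f_equal.
- rewrite sum_n_Reals. reflexivity.
- rewrite sum_n_Reals. simpl. rewrite sum_cte. apply Rmult_0_l.
Qed.

(** Comparison of coefficients through the Cauchy product: [m d_m] is [k] times the convolution of
    [h] and [d]. As [h 0 = 0], the term with [d_m] itself drops out, which leaves the defining
    recursion. *)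
Lemma exp_ode_series k h z : 0 <= k <= 1 -> (forall j, 0 <= h j <= 1) -> h 0%nat = 0 -> unit_disk z ->
  let d := complexify (exp_ode_coef k h) in
  (z * CPS (derived d) z)%C = (RtoC k * CPS (complexify h) z * CPS d z)%C.
Proof.
intros Hk Hh H0 Hz d.
assert (Td : tame d) by (apply tame_complexify; now apply exp_ode_coef_bound).
assert (Th : tame (complexify h)) by now apply tame_complexify.
assert (Hzr : 0 <= Cmod z < 1) by (split; [apply Cmod_ge_0|exact Hz]).
assert (Abs : forall a, tame a -> ex_series (fun n => Cmod (a n * z ^ n))).
{ intros a Ha. eapply ex_series_ext; [|exact (tame_ex_series a _ Ha Hzr)]. intros n. now rewrite Cmod_mult, Cmod_pow. }
assert (S1 := cseries_euler d z Td Hz).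
assert (S2 := cseries_scal (RtoC k) _ _ (cseries_mult _ _ _ _ (CPS_correct _ z Th Hz) (CPS_correct _ z Td Hz) (Abs _ Th) (Abs _ Td))).
apply cseries_unique in S1. rewrite <- S1. rewrite <- Cmult_assoc.
apply cseries_unique. eapply cseries_ext; [|exact S2].
intros n. cbv beta.
replace (sum_n (G := C_NormedModule) (fun i => complexify h i * z ^ i * (d (n - i)%nat * z ^ (n - i)))%C n)
  with (RtoC (sum_f_R0 (fun i => h i * exp_ode_coef k h (n - i)%nat)%R n) * z ^ n)%C.
2:{ rewrite <- sum_n_RtoC, Cmult_comm.
    rewrite <- (sum_n_mult_l (K := C_Ring)).
    apply sum_n_ext_loc. intros i Hi. unfold complexify, d, complexify.
    change (z ^ n * RtoC (h i * exp_ode_coef k h (n - i)%nat)%R = RtoC (h i) * z ^ i * (RtoC (exp_ode_coef k h (n - i)%nat) * z ^ (n - i)))%C.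
    rewrite RtoC_mult. replace (z ^ n)%C with (z ^ (i + (n - i)))%C by (f_equal; lia). rewrite Cpow_add_r. ring. }
rewrite Cmult_assoc. f_equal. unfold d, complexify. rewrite <- !RtoC_mult. f_equal.
destruct n as [|p].
- simpl. rewrite H0. ring.
- rewrite decomp_sum by lia. rewrite H0. simpl Nat.pred. rewrite exp_ode_coef_S.
  rewrite (sum_eq (fun i => h (S i) * exp_ode_coef k h (S p - S i)%nat) (fun j => h (S j) * exp_ode_coef k h (p - j)%nat)) by (intros; reflexivity).
  field. apply not_0_INR. lia.
Qed.

(* Coefficients of the integral of [arcsin t / t]; the index 0 gives [0 / 0 = 0]. *)
Definition arcsin_integral_coef (n : nat) : R := arcsin_coef n / INR n.

Lemma arcsin_integral_coef_bound n : 0 <= arcsin_integral_coef n <= 1.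
Proof.
unfold arcsin_integral_coef. destruct n as [|n].
- unfold arcsin_coef. unfold Rdiv. rewrite Rmult_0_l. lra.
- assert (P := INR_S_ge1 n). assert (B := arcsin_coef_bound (S n)).
  split; [apply Rdiv_le_0_compat; lra|]. apply <- Rle_div_l; lra.
Qed.

Definition arcsin_integral := CPS (complexify arcsin_integral_coef).
Definition arcsin_integral_deriv := CPS (derived (complexify arcsin_integral_coef)).

Lemma tame_arcsin_integral : tame (complexify arcsin_integral_coef).
Proof. apply tame_complexify, arcsin_integral_coef_bound. Qed.

Lemma arcsin_integral_deriv_eq z : unit_disk z -> (z * arcsin_integral_deriv z)%C = arcsin_series z.
Proof.
intros Hz. assert (S1 := cseries_euler _ z tame_arcsin_integral Hz). apply cseries_unique in S1.
transitivity (CSeries (fun n => RtoC (INR n) * complexify arcsin_integral_coef n * z ^ n)%C); [symmetry; exact S1|].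
apply cseries_unique. eapply cseries_ext; [|apply CPS_correct; [apply tame_arcsin|exact Hz]].
intros n. cbv beta. f_equal. unfold complexify. rewrite <- RtoC_mult. f_equal. unfold arcsin_integral_coef.
destruct n as [|n]; [simpl; ring|]. field. apply not_0_INR. lia.
Qed.

(** Source of the bound 2 on [arcsin_integral], whose coefficients are at most
    [1/m^2 <= 2/(m (m+1)) = 2/m - 2/(m+1)] for [m >= 1]. *)
Lemma is_series_telescope : is_series (fun n => 2 / (INR (S n) * INR (S (S n)))) 2.
Proof.
change (is_lim_seq (sum_n (fun n => 2 / (INR (S n) * INR (S (S n))))) 2).
apply (is_lim_seq_ext (fun n => 2 - 2 * / INR (S (S n)))).
- intros n. induction n as [|n IH].
  + rewrite sum_O. simpl. field.
  + rewrite sum_Sn, <- IH. unfold plus; simpl plus. change (2 - 2 * / INR (S (S (S n))) = 2 - 2 * / INR (S (S n)) + 2 / (INR (S (S n)) * INR (S (S (S n))))).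
    rewrite (S_INR (S (S n))). assert (P := INR_S_pos (S n)). field. lra.
- replace (Finite 2) with (Finite (2 - 2 * 0)) by (f_equal; ring).
  apply is_lim_seq_minus'; [apply is_lim_seq_const|]. apply is_lim_seq_mult'; [apply is_lim_seq_const|].
  apply is_lim_seq_ext with (fun n => / INR (n + 2)); [intros n; do 2 f_equal; lia|].
  apply -> (is_lim_seq_incr_n (fun n => / INR n) 2).
  apply (is_lim_seq_inv INR p_infty); [apply is_lim_seq_INR|discriminate].
Qed.

Lemma arcsin_integral_coef_0 : complexify arcsin_integral_coef 0 = RtoC 0.
Proof. unfold complexify, arcsin_integral_coef, arcsin_coef, Rdiv. now rewrite Rmult_0_l. Qed.

Lemma Cmod_arcsin_integral z : unit_disk z -> Cmod (arcsin_integral z) <= 2.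
Proof.
intros Hz. assert (S1 := cseries_shift _ _ (CPS_correct _ z tame_arcsin_integral Hz)). cbv beta in S1.
replace (CPS (complexify arcsin_integral_coef) z - _)%C with (arcsin_integral z) in S1.
2:{ unfold arcsin_integral. rewrite arcsin_integral_coef_0. ring. }
rewrite <- (is_series_unique _ _ is_series_telescope).
apply (cseries_bound _ _ _ S1); [|eexists; apply is_series_telescope].
intros n. rewrite Cmod_mult, Cmod_pow. unfold complexify. rewrite Cmod_R, Rabs_pos_eq by apply arcsin_integral_coef_bound.
assert (Hp : 0 <= Cmod z ^ S n <= 1).
{ unfold unit_disk in Hz. split; [apply pow_le, Cmod_ge_0|]. rewrite <- (pow1 (S n)). apply pow_incr. split; [apply Cmod_ge_0|lra]. }
apply Rle_trans with (arcsin_integral_coef (S n)); [generalize (arcsin_integral_coef_bound (S n)); nra|].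
unfold arcsin_integral_coef. change (arcsin_coef (S n)) with (arcsin_deriv_coef n / INR (S n)).
assert (P := INR_S_ge1 n). rewrite (S_INR (S n)). assert (B := arcsin_deriv_coef_bound n). set (x := INR (S n)) in *.
apply Rle_trans with (1 / x / x).
- unfold Rdiv. assert (0 < / x) by (apply Rinv_0_lt_compat; lra).
  repeat (apply Rmult_le_compat_r; [lra|]). lra.
- replace (1 / x / x) with (/ (x * x)) by (field; lra). replace (2 / (x * (x + 1))) with (/ (x * (x + 1) / 2)) by (field; lra).
  apply Rinv_le_contravar; nra.
Qed.

Lemma cder_pow z n : cder (fun w => w ^ S n)%C z (RtoC (INR (S n)) * z ^ n)%C.
Proof.
induction n as [|n IH].
- apply cder_ext with (fun w => w) 1; [lra|intros w _; simpl; ring|].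
  eapply cder_eq; [apply cder_id|simpl; ring].
- eapply cder_eq; [apply (cder_mult (fun w => w) (fun w => w ^ S n)%C); [apply cder_id|exact IH]|].
  rewrite (S_INR (S n)), RtoC_plus. simpl Cpow. ring.
Qed.

(** * The extremal family, its univalence and its coefficients *)

Definition kappa : R := 2 / PI.

Lemma kappa_bound : 0 < kappa < 2 / 3.
Proof.
assert (HPI3 : 3 < PI) by (generalize PI2_3_2; lra). unfold kappa, Rdiv. split.
- apply Rmult_lt_0_compat; [lra|]. apply Rinv_0_lt_compat; lra.
- apply Rmult_lt_compat_l; [lra|]. apply Rinv_lt_contravar; lra.
Qed.

Definition extremal_deriv_coef (n : nat) : nat -> R := exp_ode_coef kappa (gap n arcsin_coef).

Lemma extremal_deriv_coef_bound n m : 0 <= extremal_deriv_coef n m <= 1.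
Proof.
apply exp_ode_coef_bound; [generalize kappa_bound; lra|apply gap_bound, arcsin_coef_bound].
Qed.

Definition extremal_deriv (n : nat) : C -> C := CPS (complexify (extremal_deriv_coef n)).
Definition extremal_deriv2 (n : nat) : C -> C := CPS (derived (complexify (extremal_deriv_coef n))).

Lemma tame_extremal_deriv n : tame (complexify (extremal_deriv_coef n)).
Proof. apply tame_complexify. intros m. apply extremal_deriv_coef_bound. Qed.

Lemma extremal_deriv_ode n z : (0 < n)%nat -> unit_disk z ->
  (z * extremal_deriv2 n z)%C = (RtoC kappa * Carcsin (z ^ n) * extremal_deriv n z)%C.
Proof.
intros Hn Hz. rewrite <- arcsin_series_Carcsin by now apply unit_disk_pow. unfold arcsin_series.
rewrite <- (CPS_gap n arcsin_coef z Hn tame_arcsin Hz).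
apply exp_ode_series; [generalize kappa_bound; lra|apply gap_bound, arcsin_coef_bound| |assumption].
unfold gap. rewrite Nat.Div0.mod_0_l, Nat.Div0.div_0_l. reflexivity.
Qed.

Definition extremal_log (n : nat) (z : C) : C := (RtoC (kappa / INR n) * arcsin_integral (z ^ n))%C.

(** Both sides solve the same first-order equation, so the product with the inverse exponential has
    derivative 0 off the origin, where [z] may be cancelled. The closed form gives access to the
    argument of the derivative. *)
Lemma extremal_deriv_exp n z : (0 < n)%nat -> unit_disk z -> extremal_deriv n z = Cexp (extremal_log n z).
Proof.
intros Hn Hz. destruct n as [|k]; [lia|]. set (n := S k) in *.
set (log' := fun w => (RtoC (kappa / INR n) * (arcsin_integral_deriv (w ^ n) * (RtoC (INR n) * w ^ k)))%C).
assert (HINR : INR n <> 0) by (apply not_0_INR; lia).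
assert (Hlog : forall w, unit_disk w -> cder (extremal_log n) w (log' w)).
{ intros w Hw. apply cder_scal. apply (cder_comp arcsin_integral (fun w => w ^ n)%C).
  - apply cder_CPS; [apply tame_arcsin_integral|now apply unit_disk_pow].
  - apply cder_pow. }
assert (H : (extremal_deriv n z * Cexp (- extremal_log n z))%C = RtoC 1).
{ rewrite (disk_const (fun z => extremal_deriv n z * Cexp (- extremal_log n z))%C
    (fun z => extremal_deriv2 n z * Cexp (- extremal_log n z) + extremal_deriv n z * (Cexp (- extremal_log n z) * - log' z))%C); [| | |assumption].
  - unfold extremal_log. replace (RtoC 0 ^ n)%C with (RtoC 0) by (unfold n; simpl; ring).
    unfold arcsin_integral, extremal_deriv. rewrite !CPS_0.
    rewrite arcsin_integral_coef_0.
    replace (- (RtoC (kappa / INR n) * 0))%C with (RtoC 0) by ring. rewrite Cexp_0. unfold complexify, extremal_deriv_coef, exp_ode_coef. simpl. ring.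
  - intros w Hw. apply (cder_mult (extremal_deriv n) (fun z => Cexp (- extremal_log n z))).
    + apply cder_CPS; [apply tame_extremal_deriv|assumption].
    + apply (cder_comp Cexp (fun z => - extremal_log n z)%C); [apply cder_Cexp|]. apply cder_opp. now apply Hlog.
  - intros w Hw Hw0.
    assert (E1 := extremal_deriv_ode n w Hn Hw).
    assert (E2 : (w * log' w)%C = (RtoC kappa * Carcsin (w ^ n))%C).
    { rewrite <- arcsin_series_Carcsin, <- arcsin_integral_deriv_eq by now apply unit_disk_pow. unfold log'.
      replace (RtoC kappa) with (RtoC (kappa / INR n) * RtoC (INR n))%C by (rewrite <- RtoC_mult; f_equal; field; assumption).
      replace (w ^ n)%C with (w * w ^ k)%C by reflexivity. ring. }
    assert (E3 : (w * (extremal_deriv2 n w * Cexp (- extremal_log n w) + extremal_deriv n w * (Cexp (- extremal_log n w) * - log' w)))%C = RtoC 0).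
    { transitivity ((w * extremal_deriv2 n w - extremal_deriv n w * (w * log' w)) * Cexp (- extremal_log n w))%C; [ring|].
      rewrite E1, E2. ring. }
    destruct (Ceq_dec (extremal_deriv2 n w * Cexp (- extremal_log n w) + extremal_deriv n w * (Cexp (- extremal_log n w) * - log' w)) 0) as [E | E]; [exact E|].
    exfalso. now apply (Cmult_neq_0 _ _ Hw0 E). }
assert (H2 := Cexp_opp_mult (extremal_log n z)).
transitivity (extremal_deriv n z * Cexp (- extremal_log n z) * Cexp (extremal_log n z))%C.
- transitivity (extremal_deriv n z * (Cexp (extremal_log n z) * Cexp (- extremal_log n z)))%C; [rewrite H2|]; ring.
- rewrite H. ring.
Qed.

Lemma extremal_deriv_Re n z : (0 < n)%nat -> unit_disk z -> 0 < Re (extremal_deriv n z).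
Proof.
intros Hn Hz. rewrite extremal_deriv_exp by assumption. set (l := extremal_log n z).
assert (HPI3 : 3 < PI) by (generalize PI2_3_2; lra). assert (Hk := kappa_bound).
(* This is less than [4/3], hence less than [PI / 2]. *)
assert (Hl : Cmod l <= kappa * 2).
{ unfold l, extremal_log. destruct n as [|k]; [lia|]. assert (P := INR_S_ge1 k).
  rewrite Cmod_mult, Cmod_R, Rabs_pos_eq by (apply Rdiv_le_0_compat; lra).
  apply Rmult_le_compat; [apply Rdiv_le_0_compat; lra|apply Cmod_ge_0| |apply Cmod_arcsin_integral, unit_disk_pow; assumption].
  apply <- Rle_div_l; [|lra]. nra. }
assert (Him := Im_le_Cmod l). assert (Hb : Rabs (Im l) < PI / 2) by lra.
apply Rabs_lt_between in Hb. change (0 < exp (Re l) * cos (Im l)). apply Rmult_lt_0_compat; [apply exp_pos|]. apply cos_gt_0; lra.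
Qed.

(* Noshiro-Warschawski: on a segment from [w] to [z] the derivative of
   [Re (conj (z - w) f)] is [|z - w|^2 Re f' > 0]. *)
Lemma univalent_of_Re_deriv_pos F F1 : (forall z, unit_disk z -> cder F z (F1 z)) ->
  (forall z, unit_disk z -> 0 < Re (F1 z)) -> univalent_on unit_disk F.
Proof.
intros HF Hpos z w Hz Hw E.
destruct (Ceq_dec (z - w) 0) as [E0 | Hn].
{ transitivity (z - w + w)%C; [ring|]. rewrite E0. ring. }
exfalso. set (h := (z - w)%C) in *.
assert (Hseg : forall t, 0 <= t <= 1 -> unit_disk (w + RtoC t * h)).
{ intros t Ht. unfold h. replace (w + RtoC t * (z - w))%C with (RtoC (1 - t) * w + RtoC t * z)%C by (rewrite RtoC_minus; ring).
  unfold unit_disk in *. eapply Rle_lt_trans; [apply Cmod_triangle|]. rewrite !Cmod_mult, !Cmod_R, !Rabs_pos_eq by lra.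
  assert (M1 := Rmax_l (Cmod w) (Cmod z)). assert (M2 := Rmax_r (Cmod w) (Cmod z)).
  assert (M : Rmax (Cmod w) (Cmod z) < 1) by now apply Rmax_lub_lt.
  apply Rle_lt_trans with ((1 - t) * Rmax (Cmod w) (Cmod z) + t * Rmax (Cmod w) (Cmod z)); [|lra].
  apply Rplus_le_compat; apply Rmult_le_compat_l; lra. }
set (g := fun t => Re (Cconj h * F (w + RtoC t * h)%C)).
assert (Hg : forall t, 0 <= t <= 1 -> is_derive g t (Cmod h * Cmod h * Re (F1 (w + RtoC t * h)%C))).
{ intros t Ht.
  destruct (cder_segment (fun v => Cconj h * F v)%C w h t (Cconj h * F1 (w + RtoC t * h))%C) as [D _].
  { apply cder_scal. now apply HF, Hseg. }
  eapply is_derive_eq; [exact D|]. rewrite <- Re_scal, <- Cconj_mult_self. f_equal. ring. }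
destruct (MVT_gen g 0 1 (fun t => Cmod h * Cmod h * Re (F1 (w + RtoC t * h)%C))) as (c & Hc & Ec);
  try (rewrite Rmin_left, Rmax_right by lra).
- intros t Ht. apply Hg. lra.
- intros t Ht. eapply is_derive_continuity_pt, Hg. exact Ht.
- rewrite Rmin_left, Rmax_right in Hc by lra.
  assert (E1 : g 1 = g 0).
  { unfold g. replace (w + 1 * h)%C with z by (unfold h; ring). replace (w + 0 * h)%C with w by ring. now rewrite E. }
  rewrite E1 in Ec. assert (P := Hpos _ (Hseg c Hc)). assert (Hh : 0 < Cmod h) by now apply Cmod_gt_0.
  assert (0 < Cmod h * Cmod h * Re (F1 (w + RtoC c * h)%C)) by (repeat apply Rmult_lt_0_compat; assumption). lra.
Qed.

Definition extremal_coef (n m : nat) : R :=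
  match m with O => 0 | S m => extremal_deriv_coef n m / INR (S m) end.
Definition extremal (n : nat) : C -> C := CPS (complexify (extremal_coef n)).

Lemma tame_extremal n : tame (complexify (extremal_coef n)).
Proof.
apply tame_complexify. intros [|m]; [simpl; lra|].
change (extremal_coef n (S m)) with (extremal_deriv_coef n m / INR (S m)).
assert (P := INR_S_ge1 m). assert (B := extremal_deriv_coef_bound n m).
split; [apply Rdiv_le_0_compat; lra|]. apply <- Rle_div_l; lra.
Qed.

Lemma derived_extremal n m : derived (complexify (extremal_coef n)) m = complexify (extremal_deriv_coef n) m.
Proof.
unfold derived, complexify. rewrite <- RtoC_mult. f_equal.
change (extremal_coef n (S m)) with (extremal_deriv_coef n m / INR (S m)). field. apply not_0_INR. lia.
Qed.

Lemma cder_extremal n z : unit_disk z -> cder (extremal n) z (extremal_deriv n z).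
Proof.
intros Hz. eapply cder_eq; [apply cder_CPS; [apply tame_extremal|assumption]|].
apply CPS_ext, derived_extremal.
Qed.

Lemma extremal_expansion n : normalized_expansion (extremal n) (complexify (extremal_coef n)).
Proof.
repeat split.
- unfold complexify. simpl. unfold extremal_deriv_coef, exp_ode_coef. simpl. unfold Rdiv. now rewrite Rinv_1, Rmult_1_r.
- intros z Hz. apply is_pseries_cseries. apply CPS_correct; [apply tame_extremal|assumption].
Qed.

Lemma extremal_class n : (0 < n)%nat -> class_C_arcsin (extremal n).
Proof.
intros Hn. split; [split; [split|]|].
- intros z Hz. exists (extremal_deriv n z). apply cder_iff. now apply cder_extremal.
- exists (complexify (extremal_coef n)). apply extremal_expansion.
- apply univalent_of_Re_deriv_pos with (extremal_deriv n).
  + intros z. apply cder_extremal.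
  + intros z. now apply extremal_deriv_Re.
(* The Schwarz function is [z^n] itself. *)
- exists (fun z => z ^ n)%C. split; [split; [|split]|].
  + intros z _. destruct n as [|k]; [lia|]. eexists. apply cder_iff, cder_pow.
  + destruct n as [|k]; [lia|]. simpl. ring.
  + intros z Hz. left. now apply unit_disk_pow.
  + intros z Hz. cbv beta.
    rewrite (C_derive_CPS (extremal n) _ z (tame_extremal n) (fun _ _ => eq_refl) Hz), (C_derive2_CPS (extremal n) _ z (tame_extremal n) (fun _ _ => eq_refl) Hz).
    rewrite (CPS_ext (derived (complexify (extremal_coef n))) _ z (derived_extremal n)).
    rewrite (CPS_ext (derived (derived (complexify (extremal_coef n)))) (derived (complexify (extremal_deriv_coef n))) z).
    2:{ intros m. unfold derived at 1 3. now rewrite derived_extremal. }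
    fold (extremal_deriv n) (extremal_deriv2 n). rewrite extremal_deriv_ode by assumption. unfold kappa.
    f_equal. field. intros E0. assert (P := extremal_deriv_Re n z Hn Hz). rewrite E0 in P. simpl in P. lra.
Qed.

(** With [n = S k], the coefficients of [arcsin (z^n)] vanish below index [n] and equal 1 there. So
    only the last term of the recursion survives, paired with the constant coefficient 1 of the
    derivative. *)
Lemma extremal_coef_leading k : extremal_coef (S k) (S (S k)) = kappa / (INR (S k) * INR (S (S k))).
Proof.
change (extremal_coef (S k) (S (S k))) with (extremal_deriv_coef (S k) (S k) / INR (S (S k))).
unfold extremal_deriv_coef. rewrite exp_ode_coef_S.
assert (Hlast : gap (S k) arcsin_coef (S k) * exp_ode_coef kappa (gap (S k) arcsin_coef) (k - k)%nat = 1).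
{ unfold gap at 1. rewrite Nat.Div0.mod_same, Nat.div_same, Nat.sub_diag by lia.
  unfold exp_ode_coef. simpl. field. }
assert (Hs : sum_f_R0 (fun j => gap (S k) arcsin_coef (S j) * exp_ode_coef kappa (gap (S k) arcsin_coef) (k - j)%nat) k = 1).
{ destruct k as [|p]; [exact Hlast|]. rewrite tech5, Hlast, sum_eq_R0; [ring|].
  intros j Hj. unfold gap at 1. rewrite Nat.mod_small by lia. simpl. ring. }
rewrite Hs. field. split; apply not_0_INR; lia.
Qed.

Lemma extremal_attains n a (x : R) : (0 < n)%nat -> extremal_coef n a = x -> 0 <= x ->
  exists (f : C -> C) (c : nat -> C), class_C_arcsin f /\ normalized_expansion f c /\ Cmod (c a) = x.
Proof.
intros Hn E Hx. exists (extremal n), (complexify (extremal_coef n)).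
split; [now apply extremal_class|]. split; [apply extremal_expansion|].
unfold complexify. rewrite E, Cmod_R. now apply Rabs_pos_eq.
Qed.

Theorem theorem3p1 :
  (forall (f : C -> C) (a : nat -> C),
     class_C_arcsin f -> normalized_expansion f a ->
     Cmod (a 2%nat) <= 1 / PI /\
     Cmod (a 3%nat) <= 1 / (3 * PI) /\
     Cmod (a 4%nat) <= 1 / (6 * PI)) /\
  (exists (f : C -> C) (a : nat -> C),
     class_C_arcsin f /\ normalized_expansion f a /\
     Cmod (a 2%nat) = 1 / PI) /\
  (exists (f : C -> C) (a : nat -> C),
     class_C_arcsin f /\ normalized_expansion f a /\
     Cmod (a 3%nat) = 1 / (3 * PI)) /\
  (exists (f : C -> C) (a : nat -> C),
     class_C_arcsin f /\ normalized_expansion f a /\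
     Cmod (a 4%nat) = 1 / (6 * PI)).
Proof.
assert (HPI := PI_RGT_0).
split; [exact coefficient_bounds|].
split; [|split].
- apply (extremal_attains 1); [lia| |left; apply Rdiv_lt_0_compat; lra]. rewrite extremal_coef_leading. unfold kappa. simpl. field. lra.
- apply (extremal_attains 2); [lia| |left; apply Rdiv_lt_0_compat; lra]. rewrite extremal_coef_leading. unfold kappa. simpl. field. lra.
- apply (extremal_attains 3); [lia| |left; apply Rdiv_lt_0_compat; lra]. rewrite extremal_coef_leading. unfold kappa. simpl. field. lra.
Qed.
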